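(* Let $X$ be a Polish space and $N\ge k\ge2$. a) The set of extreme points of $\mathcal P_{N-\mathrm{rep}}(X^k)$ is given by $$E_{N,k}:=\{F_{N,k}(\lambda):\lambda\in\mathcal P_{\frac1N}(X)\}=\{M_kS_N\delta_{(x_1,\dots,x_N)}:(x_1,\dots,x_N)\in X^N\}.$$ b) Every such extreme point is also exposed.
   Context: $\mathcal P(Y)$ denotes the Borel probability measures on a Polish space $Y$. For $\gamma\in\mathcal P(X^N)$ and a permutation $\sigma$ of $\{1,\dots,N\}$, $\gamma^\sigma$ is defined by $\int\varphi\,d\gamma^\sigma=\int\varphi(x_{\sigma(1)},\dots,x_{\sigma(N)})\,d\gamma$; $S_N\gamma=\frac1{N!}\sum_\sigma\gamma^\sigma$ (analogously $S_k$ on $X^k$, extended linearly to finite signed measures). $M_k\gamma$ is the $k$-point marginal $(M_k\gamma)(A)=\gamma(A\times X^{N-k})$ (with $M_N\gamma=\gamma$). $\mathcal P_{N-\mathrm{rep}}(X^k)=\{M_k\gamma:\gamma\in\mathcal P(X^N),\ S_N\gamma=\gamma\}$ is the set of $N$-representable $k$-plans. If $C$ is a convex subset of $\mathcal P(X^k)$, $\mu\in C$ is an exposed point of $C$ if there exists $\varphi\in C_b(X^k)$ (bounded continuous) such that $\int\varphi\,d\mu<\int\varphi\,d\nu$ for every $\nu\in C\setminus\{\mu\}$. $\mathcal P_{\frac1N}(X)=\{\frac1N\sum_{i=1}^N\delta_{x_i}: x_1,\dots,x_N\in X\text{ not necessarily distinct}\}$. For $\lambda\in\mathcal P(X)$,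 $\lambda^{\otimes m}$ is the $m$-fold product (factor omitted if $m=0$) and $\mathrm{id}^{\otimes m}_\#\lambda$ the push-forward of $\lambda$ under $x\mapsto(x,\dots,x)\in X^m$. A partition of $j\in\mathbb N$ of length $n$ is $\mathbf p=(p_1\ge\dots\ge p_n)\in\mathbb N^n$ ($\mathbb N=\{1,2,\dots\}$) with $\sum p_i=j$; $n(\mathbf p)=n$; $\mathrm{Ran}\,\mathbf p$ is the set of values of its components and $|\mathbf p^{-1}(q)|$ the number of components equal to $q$. Define $$F_{N,k}(\lambda)=\frac{N^{k-1}}{\prod_{i=1}^{k-1}(N-i)}\Big[\lambda^{\otimes k}+\sum_{j=1}^{k-1}\frac{(-1)^j}{N^j}S_kP_j^{(k)}(\lambda)\Big],$$ $$P_j^{(k)}(\lambda)=\sum_{\substack{\mathbf p\text{ partition of }j\\ j+n(\mathbf p)\le k}}d_{\mathbf p}^{(k)}\,\mathrm{id}^{\otimes(p_1+1)}_\#\lambda\otimes\cdots\otimes\mathrm{id}^{\otimes(p_{n(\mathbf p)}+1)}_\#\lambda\otimes\lambda^{\otimes(k-j-n(\mathbf p))},$$ $$d_{\mathbf p}^{(k)}=\frac{k!}{(k-j-n(\mathbf p))!}\prod_{i=1}^{n(\mathbf p)}\frac1{p_i+1}\prod_{q\in\mathrm{Ran}\,\mathbf p}\frac1{(|\mathbf p^{-1}(q)|)!}.$$ *)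

(* Defs.v *)
From HB Require Import structures.
From mathcomp Require Import all_boot all_order all_algebra all_fingroup.
From mathcomp Require Import all_classical all_reals all_analysis.

Unset Printing Implicit Defensive.

Import Order.TTheory GRing.Theory Num.Theory.
Import numFieldNormedType.Exports.

Local Open Scope classical_set_scope.
Local Open Scope ring_scope.

(* The library only provides measurable structures on pointed types, whence
   [ptopologicalType] for the ambient space. *)
Definition polish (R : realType) (X : ptopologicalType) : Prop :=
  (exists2 D : set X, countable D & dense D) /\
  exists d : X -> X -> R,
    [/\ (forall x y, 0 <= d x y) /\ (forall x y, d x y = 0 <-> x = y),
        (forall x y, d x y = d y x) /\
          (forall x y z, d x z <= d x y + d y z),
        (forall (x : X) (A : set X),
          nbhs x A <-> exists2 e, 0 < e & [set y | d x y < e] `<=` A)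
      & (forall u : nat -> X,
          (forall e, 0 < e -> exists n0, forall m n,
            (n0 <= m)%N -> (n0 <= n)%N -> d (u m) (u n) < e) ->
          exists l : X, u @ \oo --> l) ].

(* X ^ m with the product topology; its elements are the functions from 'I_m
   to X. *)
Definition power (X : Type) (m : nat) : Type := prod_topology (fun _ : 'I_m => X).
HB.instance Definition _ (X : topologicalType) m :=
  Topological.copy (power X m) (prod_topology (fun _ : 'I_m => X)).
HB.instance Definition _ (X : ptopologicalType) m :=
  isPointed.Build (power X m) (fun _ => point).

Definition borel (T : ptopologicalType) : Type := g_sigma_algebraType (@open T).
HB.instance Definition _ (T : ptopologicalType) :=
  Measurable.copy (borel T) (g_sigma_algebraType (@open T)).

(* The library identifies measures only when they also agree on the sets that
   are not measurable, so equality of measures is always taken as the relation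
   [=mu], and equality of sets of measures as [eq_mset]. *)
Definition eq_meas {d} {T : measurableType d} {R : realType}
    (m1 m2 : set T -> \bar R) : Prop :=
  forall A, measurable A -> m1 A = m2 A.
Notation "m1 =mu m2" := (eq_meas m1 m2) (at level 70).

Definition eq_mset {d} {T : measurableType d} {R : realType}
    (S1 S2 : set (set T -> \bar R)) : Prop :=
  (forall m, S1 m -> exists2 m', S2 m' & m =mu m') /\
  (forall m, S2 m -> exists2 m', S1 m' & m =mu m').

Section convexity.
Context {R : realType}.

Definition extreme_points {d} {T : measurableType d} (C : set (probability T R)) :
    set (probability T R) :=
  [set mu | C mu /\
    forall (nu1 nu2 : probability T R) (t : R), C nu1 -> C nu2 -> 0 < t < 1 ->
      mu =mu (fun A => t%:E * nu1 A + (1 - t)%:E * nu2 A)%E ->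
      nu1 =mu mu /\ nu2 =mu mu].

Definition exposed_points {Y : ptopologicalType}
    (C : set (probability (borel Y) R)) : set (probability (borel Y) R) :=
  [set mu | C mu /\
    exists phi : Y -> R,
      [/\ continuous phi,
          exists M : R, forall y, `|phi y| <= M
        & forall nu : probability (borel Y) R, C nu -> ~ (nu =mu mu) ->
            (\int[mu]_y (phi y)%:E < \int[nu]_y (phi y)%:E)%E]].

End convexity.

Section plans.
Context {R : realType} {X : ptopologicalType}.

(* Set functions on X ^ m: Borel measures and signed measures alike. *)
Notation mfun m := (set (borel (power X m)) -> \bar R).

Definition permute {m} (s : 'S_m) (gamma : mfun m) : mfun m :=
  pushforward gamma
    (fun x : borel (power X m) => (fun i => x (s i)) : borel (power X m)).

Definition symm {m} (gamma : mfun m) : mfun m :=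
  fun A => ((m`!%:R^-1)%:E * \sum_(s : 'S_m) permute s gamma A)%E.

Definition marginal {k N} (hkN : (k <= N)%N) (gamma : mfun N) : mfun k :=
  pushforward gamma
    (fun x : borel (power X N) =>
       (fun i => x (widen_ord hkN i)) : borel (power X k)).

Definition Nrep {k N} (hkN : (k <= N)%N) : set (probability (borel (power X k)) R) :=
  [set mu | exists gamma : probability (borel (power X N)) R,
     symm gamma =mu gamma /\ mu =mu marginal hkN gamma].

Definition quantized N : set (probability (borel X) R) :=
  [set la | exists x : 'I_N -> X,
     la =mu (fun A => (N%:R^-1)%:E * \sum_(i < N) dirac (x i : borel X) A)%E].

Definition concat {a b} (y : borel (power X a) * borel (power X b)) :
    borel (power X (a + b)) :=
  fun i => match fintype.split i with inl u => y.1 u | inr v => y.2 v end.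

(* [\x] is formed with the Borel sections of a set; X being second countable,
   Borel sets of X ^ (a + b) correspond to the product sigma-algebra of
   X ^ a * X ^ b, so this is the product measure on X ^ (a + b). *)
Definition tensor {a b} (mu : mfun a) (nu : mfun b) : mfun (a + b) :=
  pushforward (mu \x nu)%E concat.

Definition id_push (la : set (borel X) -> \bar R) m : mfun m :=
  pushforward la (fun x : borel X => (fun _ => x) : borel (power X m)).

(* la ^ (x) m; for m = 0 this is the unit mass on the one-point space X ^ 0,
   so that the factor disappears from products. *)
Fixpoint tpower (la : set (borel X) -> \bar R) m : mfun m :=
  if m is m'.+1 then tensor (id_push la 1) (tpower la m')
  else dirac (point : borel (power X 0)).

Definition tdim (p : seq nat) (m : nat) : nat := foldr (fun q n => q.+1 + n)%N m p.

(* id_push la (p_1 + 1) (x) ... (x) id_push la (p_n + 1) (x) la ^ (x) m *)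
Fixpoint blocks (la : set (borel X) -> \bar R) (p : seq nat) m :
    mfun (tdim p m) :=
  if p is q :: p' then tensor (id_push la q.+1) (blocks la p' m)
  else tpower la m.

Definition recast {a b} (e : b = a) (mu : mfun a) : mfun b :=
  pushforward mu
    (fun x : borel (power X a) =>
       (fun i => x (cast_ord e i)) : borel (power X b)).

End plans.

Definition is_partition (j : nat) (p : seq nat) : bool :=
  [&& sorted geq p, all (leq 1) p & sumn p == j].

(* A partition of j has at most j parts, each of them at most j, so the
   partitions of j all occur (exactly once) in this finite type. *)
Definition parts {j} (p : j.-bseq 'I_j.+1) : seq nat := map val (bseqval p).

(* The partitions p of j with j + n(p) <= k. *)
Definition admissible k j : finType :=
  {p : j.-bseq 'I_j.+1 |
    is_partition j (parts p) && (j + size (parts p) <= k)%N}.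

Lemma parts_complete j (q : seq nat) : is_partition j q ->
  exists! p : j.-bseq 'I_j.+1, parts p = q.
Proof.
move=> /and3P[_ q1 /eqP sq].
have sizeq : (size q <= j)%N.
  rewrite -sq; elim: q q1 {sq} => //= a q IH /andP[a1 /IH h].
  by rewrite -add1n leq_add.
have mapq : map val (map (@inord j) q) = q.
  rewrite -map_comp -[RHS]map_id; apply/eq_in_map => a aq /=.
  rewrite inordK// ltnS -sq; elim: q aq {q1 sq sizeq} => //= b q IH.
  rewrite inE => /predU1P[->|/IH]; first exact: leq_addr.
  by move=> h; exact: leq_trans h (leq_addl _ _).
have sz : (size (map (@inord j) q) <= j)%N by rewrite size_map.
exists (Bseq sz); split => // p' p'q; apply: val_inj => /=.
by apply: (inj_map val_inj); rewrite mapq -p'q.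
Qed.

Lemma tdimE {k j} (p : admissible k j) :
  k = tdim (parts (val p)) (k - j - size (parts (val p))).
Proof.
have /andP[/and3P[_ _ /eqP sp]] := valP p.
move: (parts (val p)) sp => q sq qk.
suff -> m : tdim q m = (sumn q + size q + m)%N.
  by rewrite sq -subnDA subnKC.
elim: {sq qk} q => //= a q ->.
by rewrite addSn !addnA -addSn addnS (addnAC a).
Qed.

Section extreme_plans.
Context {R : realType} {X : ptopologicalType}.
Notation mfun m := (set (borel (power X m)) -> \bar R).

Definition dcoef k j (p : seq nat) : R :=
  k`!%:R / (k - j - size p)`!%:R
  * (\prod_(q <- p) q.+1%:R^-1)
  * (\prod_(q <- undup p) (count_mem q p)`!%:R^-1).

Definition Pmeas k j (la : set (borel X) -> \bar R) : mfun k := fun A =>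
  (\sum_(p : admissible k j)
     (dcoef k j (parts (val p)))%:E *
     recast (tdimE p)
       (blocks la (parts (val p)) (k - j - size (parts (val p)))) A)%E.

Definition Fmeas N k (la : set (borel X) -> \bar R) : mfun k := fun A =>
  ((N%:R ^+ k.-1 / \prod_(1 <= i < k) (N%:R - i%:R))%:E *
   (tpower la k A +
    \sum_(1 <= j < k) ((-1) ^+ j / N%:R ^+ j)%:E * symm (Pmeas k j la) A))%E.

Definition EF (N k : nat) : set (mfun k) :=
  [set Fmeas N k la | la in quantized N].

Definition Edirac {N k} (hkN : (k <= N)%N) : set (mfun k) :=
  [set marginal hkN (symm (dirac (x : borel (power X N)))) | x in [set: 'I_N -> X]].

End extreme_plans.

(* Main.v *)
(** The Newton-Girard identities express the normalised sum of a symmetric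
    function over injective words of length k as a signed sum, over partitions
    of k, of power sums; the coefficients are those of F_{N,k}, so that
    F_{N,k}(lambda) = M_k S_N delta_x when lambda is the empirical measure of x.

    If mu = M_k gamma is extreme and A is a symmetric Borel set with
    gamma A > 0, conditioning gamma on A does not change the k-point marginal.
    Applied to the level sets of y |-> (M_k S_N delta_y)(B), this shows that
    this function is gamma-a.e. equal to mu B; letting B run through a countable
    pi-system generating the Borel sets yields a y with mu = M_k S_N delta_y.

    Conversely, a function phi of the first two coordinates (this is where
    k >= 2 is used) can be chosen so that its S_N-average at y is, up to a
    constant, sum_j g(y_j) + sum_i (sum_j f_i(y_j) - sum_j f_i(x_j))^2, which
    vanishes exactly on the orbit of x; this phi exposes M_k S_N delta_x. *)
Require Import Defs.
From HB Require Import structures.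
From mathcomp Require Import all_boot all_order all_algebra all_fingroup.
From mathcomp Require Import all_classical all_reals all_analysis measurable_realfun.
From mathcomp Require Import ring lra zify.

Import Order.TTheory GRing.Theory Num.Theory.
Import numFieldNormedType.Exports.

Local Open Scope classical_set_scope.
Local Open Scope ring_scope.

(** * Newton-Girard identities *)

Section words.
Context {R : numFieldType} {T : finType}.
Implicit Types (lam : seq nat) (g : seq T -> R).

Fixpoint words lam : seq (seq T) :=
  if lam is c :: lam' then [seq nseq c i ++ w | i <- enum T, w <- words lam']
  else [:: [::]].

Definition perm_invariant g := forall u v, perm_eq u v -> g u = g v.

(** When [g] is multiplicative, [g w] being the product of z_i over the letters i of [w], this is
    the product of the power sums p_c(z) over the parts c of [lam]. General [g] are allowed so that
    indicators of sets are covered. *)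
Definition psum lam g : R := \sum_(w <- words lam) g w.

Lemma psum_nil g : psum [::] g = g [::].
Proof. by rewrite /psum big_seq1. Qed.

Lemma psum_cons c lam g :
  psum (c :: lam) g = \sum_(i : T) psum lam (fun w => g (nseq c i ++ w)).
Proof. by rewrite /psum /= big_allpairs_dep big_enum. Qed.

Lemma size_words lam w : w \in words lam -> size w = sumn lam.
Proof.
elim: lam w => [w|c lam IH w] /=; first by rewrite inE => /eqP->.
by case/allpairsP => -[i v] /= [_ /IH vl ->]; rewrite size_cat size_nseq vl.
Qed.

(** By invariance of [g], the block of length c moves past those preceding it. *)
Lemma psum_rem c lam g : perm_invariant g -> c \in lam ->
  psum lam g = psum (c :: rem c lam) g.
Proof.
elim: lam g => // a lam IH g gP; rewrite inE /= eq_sym.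
have [->//|ac /= clam] := eqVneq a c.
rewrite [LHS]psum_cons (eq_bigr _ (fun i _ => IH (fun w => g (nseq a i ++ w)) _ clam)).
  under eq_bigr do rewrite psum_cons.
  rewrite exchange_big psum_cons; apply: eq_bigr => i _ /=.
  rewrite psum_cons; apply: eq_bigr => j _; apply: eq_bigr => w _ /=.
  by apply: gP; rewrite perm_catCA.
by move=> i _ u v uv; apply: gP; rewrite perm_cat2l.
Qed.

Lemma perm_invariant_cat g u : perm_invariant g -> perm_invariant (fun w => g (u ++ w)).
Proof. by move=> gP v w vw; apply: gP; rewrite perm_cat2l. Qed.

End words.

Section injective_words.
Context {R : numFieldType} {N : nat}.
Implicit Types (m c : nat) (g : seq 'I_N -> R) (u v w : seq 'I_N).

(** The permutation is built letter by letter: the transposition of [t a] and [b] corrects [t] at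
    [a] and fixes the letters of [v], which contains neither. *)
Lemma perm_map_uniq u v : uniq u -> uniq v -> size u = size v ->
  exists t : 'S_N, map t u = v.
Proof.
elim: u v => [[]//|a u IH [//|b v]] /=; first by exists 1%g.
move=> /andP[au uu] /andP[bv uv] [/(IH _ uu uv)[t tuv]].
exists (t * tperm (t a) b)%g; rewrite permM tpermL; congr (_ :: _).
rewrite -[RHS]map_id -tuv -map_comp; apply/eq_in_map => x xu /=.
rewrite permM tpermD//; first by apply: contraNneq au => /perm_inj->.
by apply: contraNneq bv => ->; rewrite -tuv map_f.
Qed.

(** For m <= N each injective word of length m is counted (N - m)! times; for m > N the prefix is
    truncated to length N, and [elem] multiplies by [N ^_ m] = 0. *)
Definition prefix_sum m g : R := \sum_(s : 'S_N) g (map s (take m (enum 'I_N))).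

Lemma prefix_sum_uniq u g : uniq u ->
  \sum_(s : 'S_N) g (map s u) = prefix_sum (size u) g.
Proof.
move=> uu; have uN : (size u <= N)%N.
  by rewrite -[leqRHS]card_ord -(card_uniqP uu) max_card.
have [|||t tu] := @perm_map_uniq u (take (size u) (enum 'I_N)) => //.
- by rewrite take_uniq// enum_uniq.
- by rewrite size_take size_enum_ord; case: ltngtP uN.
rewrite /prefix_sum -tu (reindex_inj (mulgI t)) /=.
by apply: eq_bigr => s _; congr g; rewrite -map_comp; apply/eq_map => i; rewrite /= permM.
Qed.

Definition repeat_head c g : seq 'I_N -> R := fun w =>
  if w is i :: w' then g (nseq c i ++ w') else 0.

(** The additional letter j is either one of the m letters of the injective word, and its block
    grows to c + 1 copies, or one of the N - m others, and a longer injective word arises. *)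
Lemma prefix_sum_step c m g : (m <= N)%N -> perm_invariant g ->
  \sum_(j < N) prefix_sum m (fun w => g (nseq c j ++ w)) =
  m%:R * prefix_sum m (repeat_head c.+1 g) + (N - m)%:R * prefix_sum m.+1 (repeat_head c g).
Proof.
move=> mN gP; rewrite exchange_big /=; set u := take m _.
have uu : uniq u by rewrite take_uniq// enum_uniq.
have su : size u = m by rewrite size_take size_enum_ord; case: ltngtP mN.
(* For each [s] the letter j is written as [s l], so that the case distinction on [l] being in [u]
   does not depend on [s]. *)
transitivity (\sum_(l < N) \sum_(s : 'S_N) g (nseq c (s l) ++ map s u)).
  rewrite [RHS]exchange_big; apply: eq_bigr => s _.
  by rewrite (reindex_inj (@perm_inj _ s)).
rewrite (bigID (mem u)) /=; congr (_ + _).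
  under eq_bigr => l lu.
    rewrite (eq_bigr (fun s : 'S_N => repeat_head c.+1 g (map s (l :: rem l u))));
      last first.
      move=> s _; rewrite [RHS](_ : _ = g (nseq (c + 1) (s l) ++ map s (rem l u)));
        last by rewrite addn1.
      rewrite nseqD -catA; apply: gP.
      by rewrite perm_cat2l cat1s -map_cons perm_map// perm_to_rem.
    rewrite prefix_sum_uniq; last by rewrite /= mem_rem_uniqF ?rem_uniq.
    rewrite /= size_rem// su prednK; last by rewrite -su; case: (u) lu.
  over.
  by rewrite sumr_const (card_uniqP uu) su mulr_natl.
under eq_bigr => l lu.
  rewrite (prefix_sum_uniq (l :: u) (repeat_head c g)); last by rewrite /= lu.
  rewrite /= su; over.
rewrite sumr_const [RHS]mulr_natl; congr (_ *+ _).
have := cardC (mem u); rewrite (card_uniqP uu) su card_ord => uN.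
by apply: (@addnI m); rewrite subnKC// -{}uN; congr (_ + _)%N; apply: eq_card.
Qed.

(* [N ^_ m / N`!] turns a sum over all permutations into a sum over the
   injective words of length m, and [1 / m`!] counts each set of letters once. *)
Definition elem m g : R := (N ^_ m)%:R / N`!%:R / m`!%:R * prefix_sum m g.

Lemma elem0 g : elem 0 g = g [::].
Proof.
rewrite /elem /prefix_sum take0 /= sumr_const card_Sn ffactn0 fact0 divr1 mul1r.
by rewrite -[X in _ * X]mulr_natl mulrA mulVf ?mul1r// pnatr_eq0 -lt0n fact_gt0.
Qed.

(** Newton's identity k e_k = sum_i (-1)^i p_{i+1} e_{k-1-i}, obtained by telescoping
    [prefix_sum_step]. *)
Lemma elem_newton k g : (0 < k)%N -> perm_invariant g ->
  k%:R * elem k g = \sum_(0 <= i < k) (-1) ^+ i *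
    \sum_(j < N) elem (k.-1 - i) (fun w => g (nseq i.+1 j ++ w)).
Proof.
case: k => // k _ gP.
have fn0 n : n`!%:R != 0 :> R by rewrite pnatr_eq0 -lt0n fact_gt0.
(* The multiplicity c of the first letter is kept general because each use of the recursion [E]
   lowers m and raises c; the lemma is the case c = 1. *)
suff H m c : (N ^_ m.+1)%:R / N`!%:R / m`!%:R * prefix_sum m.+1 (repeat_head c g) =
    \sum_(0 <= i < m.+1) (-1) ^+ i *
      \sum_(j < N) elem (m - i) (fun w => g (nseq (c + i) j ++ w)).
  transitivity ((N ^_ k.+1)%:R / N`!%:R / k`!%:R * prefix_sum k.+1 (repeat_head 1 g)).
    rewrite /elem factS natrM invfM.
    case: (leqP k.+1 N) => [kN|kN]; last by rewrite ffact_small// !mul0r mulr0.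
    have -> : prefix_sum k.+1 (repeat_head 1 g) = prefix_sum k.+1 g.
      apply: eq_bigr => s _.
      case: (map s _) (size_map s (take k.+1 (enum 'I_N))) => //.
      by rewrite size_takel ?size_enum_ord.
    have := fn0 k; have := fn0 N; have : k.+1%:R != 0 :> R by rewrite pnatr_eq0.
    by move=> h1 h2 h3; field; rewrite nat1r h1 h2 h3.
  rewrite H; apply: eq_bigr => i _; congr (_ * _).
move: m c.
have E m c : (N ^_ m.+1)%:R * prefix_sum m.+1 (repeat_head c g) =
  (N ^_ m)%:R * \sum_(j < N) prefix_sum m (fun w => g (nseq c j ++ w)) -
  m%:R * ((N ^_ m)%:R * prefix_sum m (repeat_head c.+1 g)).
  have [mN|mN] := leqP m N; first by rewrite prefix_sum_step// ffactnSr natrM; ring.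
  by rewrite !ffact_small ?mul0r ?mulr0 ?subrr// ltnW.
have El m c : \sum_(j < N) elem m (fun w => g (nseq c j ++ w)) =
    (N ^_ m)%:R / N`!%:R / m`!%:R *
    \sum_(j < N) prefix_sum m (fun w => g (nseq c j ++ w)).
  by rewrite mulr_sumr.
have E' m c : (N ^_ m.+1)%:R / N`!%:R / m`!%:R * prefix_sum m.+1 (repeat_head c g) =
    ((N ^_ m)%:R * \sum_(j < N) prefix_sum m (fun w => g (nseq c j ++ w)) -
    m%:R * ((N ^_ m)%:R * prefix_sum m (repeat_head c.+1 g))) / N`!%:R / m`!%:R.
  by rewrite -E mulrAC -!mulrA; congr (_ * _); rewrite mulrCA.
elim=> [|m IH] c.
  by rewrite big_nat1 expr0 mul1r addn0 subn0 El E' mul0r subr0; ring.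
rewrite big_nat_recl// expr0 mul1r addn0 subn0.
transitivity (\sum_(j < N) elem m.+1 (fun w => g (nseq c j ++ w)) -
  (N ^_ m.+1)%:R / N`!%:R / m`!%:R * prefix_sum m.+1 (repeat_head c.+1 g)).
  rewrite El E' factS natrM.
  have := fn0 m; have := fn0 N; have : m.+1%:R != 0 :> R by rewrite pnatr_eq0.
  by move=> h1 h2 h3; field; rewrite nat1r h1 h2 h3.
rewrite IH; congr (_ + _); rewrite -sumrN; apply: eq_bigr => i _.
by rewrite exprS mulN1r mulNr subSS addSnnS.
Qed.

End injective_words.

(** * Partitions of an integer *)

Definition partitions k : seq (seq nat) :=
  [seq parts p | p <- enum {: k.-bseq 'I_k.+1} & is_partition k (parts p)].

Lemma mem_partitions k lam : (lam \in partitions k) = is_partition k lam.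
Proof.
apply/mapP/idP => [[p + ->]|lamk]; first by rewrite mem_filter => /andP[].
have [p [plam _]] := parts_complete _ _ lamk.
by exists p => //; rewrite mem_filter plam lamk mem_enum.
Qed.

Lemma parts_inj k : injective (@parts k).
Proof. by move=> p q /(inj_map val_inj) /val_inj. Qed.

Lemma partitions_uniq k : uniq (partitions k).
Proof. by rewrite map_inj_uniq => [|p q /parts_inj]//; apply: filter_uniq;
  exact: enum_uniq. Qed.

Lemma geq_trans : transitive geq.
Proof. by move=> a b c /= /[swap]; exact: leq_trans. Qed.

Lemma geq_anti : antisymmetric geq.
Proof. by move=> a b /=; rewrite andbC -eqn_leq => /eqP. Qed.

Lemma geq_total : total geq.
Proof. by move=> a b /=; rewrite leq_total. Qed.

(** Sorted insertion of a part c and its removal are inverse bijections between the partitions of k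
    - c and the partitions of k containing c; this lemma and the next three give the two directions
    and the two cancellations. *)
Lemma is_partition_sort k c lam : (0 < c <= k)%N ->
  is_partition (k - c) lam -> is_partition k (sort geq (c :: lam)).
Proof.
move=> /andP[c0 ck] /and3P[_ lam1 /eqP lamk]; apply/and3P; split.
- exact: (sort_sorted geq_total).
- by rewrite all_sort /= c0.
- by rewrite (perm_sumn (permEl (perm_sort geq (c :: lam)))) /= lamk subnKC.
Qed.

Lemma is_partition_rem k c lam : c \in lam ->
  is_partition k lam -> is_partition (k - c) (rem c lam).
Proof.
move=> clam /and3P[slam lam1 /eqP <-]; apply/and3P; split.
- exact: subseq_sorted geq_trans _ _ (rem_subseq _ _) slam.
- by apply/allP => i /mem_rem; move: i; apply/allP.
- by rewrite (perm_sumn (perm_to_rem clam)) /= addKn.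
Qed.

Lemma sort_cons_rem c lam : c \in lam -> sorted geq lam ->
  sort geq (c :: rem c lam) = lam.
Proof.
move=> clam slam; rewrite -[RHS](sorted_sort geq_trans slam).
apply/(perm_sortP geq_total geq_trans geq_anti).
by rewrite perm_sym perm_to_rem.
Qed.

Lemma rem_sort_cons c lam : sorted geq lam -> rem c (sort geq (c :: lam)) = lam.
Proof.
move=> sl.
have ss : sorted geq (rem c (sort geq (c :: lam))).
  by apply: subseq_sorted geq_trans _ _ (rem_subseq _ _) _; exact: (sort_sorted geq_total).
apply: (sorted_eq geq_trans geq_anti) => //.
rewrite -(perm_cons c) perm_sym -(permPl (permEl (perm_sort geq (c :: lam)))).
by rewrite perm_to_rem// mem_sort mem_head.
Qed.

Lemma partition_size k lam : is_partition k lam -> (size lam <= k)%N.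
Proof.
move=> /and3P[_ + /eqP <-]; elim: lam => //= c lam IH /andP[c0 /IH].
by rewrite -add1n; exact: leq_add.
Qed.

Lemma partitions0 : perm_eq (partitions 0) [:: [::]].
Proof.
apply: uniq_perm => //; first exact: partitions_uniq.
move=> lam; rewrite mem_partitions inE; apply/idP/eqP => [/partition_size|->//].
by rewrite leqn0 size_eq0 => /eqP.
Qed.

Section partition_sums.
Context {R : numFieldType}.

(* The number of permutations of cycle type [lam] is [(sumn lam)`! / zee lam]. *)
Definition zee (lam : seq nat) : R :=
  \prod_(c <- lam) c%:R * \prod_(c <- undup lam) (count_mem c lam)`!%:R.

Lemma prod_count_undup (lam s : seq nat) : uniq s -> {subset lam <= s} ->
  \prod_(c <- undup lam) (count_mem c lam)`!%:R =
  \prod_(c <- s) (count_mem c lam)`!%:R :> R.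
Proof.
move=> us lams; rewrite [RHS](bigID (mem lam)) /= [X in _ * X]big1 ?mulr1; last first.
  by move=> q /count_memPn->.
rewrite -[RHS]big_filter; apply: perm_big; apply: uniq_perm.
- exact: undup_uniq.
- exact: filter_uniq.
by move=> q; rewrite mem_filter mem_undup /=; case: (boolP (q \in lam)) => // /lams.
Qed.

Lemma zee_neq0 lam : all (leq 1) lam -> zee lam != 0.
Proof.
move=> /allP lam1; rewrite mulf_neq0// prodf_seq_neq0; apply/allP => c /=.
  by move=> /lam1; rewrite pnatr_eq0 -lt0n.
by move=> _; rewrite pnatr_eq0 -lt0n fact_gt0.
Qed.

(** Removing one copy of c takes a factor c from the product of the parts and turns m! into (m -
    1)!, where m is the multiplicity of c. *)
Lemma zee_rem c lam : c \in lam ->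
  zee lam = c%:R * (count_mem c lam)%:R * zee (rem c lam).
Proof.
move=> clam; rewrite /zee (perm_big _ (perm_to_rem clam)) big_cons -!mulrA.
congr (_ * _); rewrite mulrCA; congr (_ * _).
rewrite (prod_count_undup (rem c lam) (undup lam)) ?undup_uniq//; last first.
  by move=> q /mem_rem; rewrite mem_undup.
rewrite (bigD1_seq c) ?mem_undup ?undup_uniq//=.
rewrite [in RHS](bigD1_seq c) ?mem_undup ?undup_uniq//= mulrA.
congr (_ * _).
  rewrite count_mem_rem eqxx.
  have : (0 < count_mem c lam)%N by rewrite -has_count has_pred1.
  by case: (count_mem c lam) => // n _; rewrite subn1 /= factS natrM.
by apply: eq_bigr => q qc; rewrite count_mem_rem eq_sym (negbTE qc) subn0.
Qed.

Lemma sumn_count lam : sumn lam = (\sum_(c <- undup lam) c * count_mem c lam)%N.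
Proof.
rewrite sumnE -big_undup_iterop_count /=.
by apply: eq_bigr => c _; rewrite Monoid.iteropE iter_addn_0.
Qed.

(** The factor k is the sum over the distinct parts c of [lam] of c times its multiplicity, which by
    [zee_rem] is [zee lam / zee (rem c lam)]. Exchanging the sums and removing c = i + 1 leaves a
    partition of k - c. *)
Lemma sum_partitions_rem k (f : seq nat -> R) :
  k%:R * \sum_(lam <- partitions k) f lam / zee lam =
  \sum_(0 <= i < k) \sum_(lam <- partitions (k.-1 - i))
    f (sort geq (i.+1 :: lam)) / zee lam.
Proof.
transitivity (\sum_(lam <- partitions k) \sum_(0 <= i < k | i.+1 \in lam)
    f lam / zee (rem i.+1 lam)).
  rewrite mulr_sumr !big_seq; apply: eq_bigr => lam.
  rewrite mem_partitions => /and3P[slam lam1 /eqP lamk].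
  rewrite -{1}lamk sumn_count natr_sum mulr_suml.
  transitivity (\sum_(c <- undup lam) f lam / zee (rem c lam)).
    rewrite !big_seq; apply: eq_bigr => c; rewrite mem_undup => clam.
    rewrite (zee_rem _ _ clam) natrM.
    have c0 : c%:R != 0 :> R by rewrite pnatr_eq0 -lt0n (allP lam1).
    have n0 : (count_mem c lam)%:R != 0 :> R.
      by rewrite pnatr_eq0 -lt0n -has_count has_pred1.
    have z0 : zee (rem c lam) != 0.
      by apply: zee_neq0; apply/allP => i /mem_rem; move: i; apply/allP.
    by field; rewrite z0 n0 c0.
  rewrite -[RHS](big_map S (mem lam) (fun c => f lam / zee (rem c lam))).
  rewrite -[RHS]big_filter; apply: perm_big; apply: uniq_perm.
  - exact: undup_uniq.
  - by rewrite filter_uniq// map_inj_uniq ?iota_uniq//; exact: succn_inj.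
  move=> c; rewrite mem_undup mem_filter /=; case: (boolP (c \in lam)) => //= clam.
  apply/esym/mapP; exists c.-1.
    rewrite mem_index_iota /= prednK ?(allP lam1)// -lamk.
    by rewrite (perm_sumn (perm_to_rem clam)) /= leq_addr.
  by rewrite prednK ?(allP lam1).
rewrite (exchange_big_dep xpredT)//= big_nat [RHS]big_nat.
apply: eq_bigr => i /= ik.
rewrite -big_filter; set P := partitions (_ - _).
rewrite (eq_big_seq (fun lam => f (sort geq (i.+1 :: rem i.+1 lam)) / zee (rem i.+1
  lam))); last first.
  move=> lam; rewrite mem_filter mem_partitions => /andP[ilam /and3P[slam _ _]].
  by rewrite sort_cons_rem.
rewrite -(big_map (rem i.+1) xpredT (fun lam => f (sort geq (i.+1 :: lam)) / zee lam)).
apply: perm_big; apply: uniq_perm.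
- rewrite map_inj_in_uniq ?filter_uniq ?partitions_uniq// => u v.
  rewrite !mem_filter !mem_partitions => /andP[iu /and3P[su _ _]] /andP[iv /and3P[sv _ _]].
  by move=> uv; rewrite -(sort_cons_rem _ _ iu su) uv sort_cons_rem.
- exact: partitions_uniq.
have kE : (k.-1 - i = k - i.+1)%N by lia.
move=> lam; rewrite mem_partitions kE; apply/mapP/idP => [[u]|lamk].
  by rewrite mem_filter mem_partitions => /andP[iu ku] ->; exact: is_partition_rem.
have slam := is_partition_sort _ _ _ (_ : (0 < i.+1 <= k)%N) lamk.
exists (sort geq (i.+1 :: lam)).
  by rewrite mem_filter mem_partitions mem_sort mem_head slam//.
by have [sl _ _] := and3P lamk; rewrite rem_sort_cons.
Qed.

End partition_sums.

(** * Elementary sums as signed combinations of power sums *)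

Section newton_girard.
Context {R : numFieldType}.

(** The classical sum of eps_lam p_lam / z_lam, where eps_lam is the signature of a permutation of
    cycle type [lam]. *)
Definition psum_exp {T : finType} k (g : seq T -> R) : R :=
  \sum_(lam <- partitions k) (-1) ^+ (k - size lam) * psum lam g / zee lam.

(** Adding a part i + 1 to a partition of k - 1 - i raises the excess, the total minus the number of
    parts, by i; this gives the sign (-1)^i of Newton's identity. *)
Lemma psum_exp_newton {T : finType} k (g : seq T -> R) : perm_invariant g ->
  k%:R * psum_exp k g = \sum_(0 <= i < k) (-1) ^+ i *
    \sum_(j : T) psum_exp (k.-1 - i) (fun w => g (nseq i.+1 j ++ w)).
Proof.
move=> gP; rewrite sum_partitions_rem !big_nat; apply: eq_bigr => i /= ik.
under [in RHS]eq_bigr do rewrite /psum_exp.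
rewrite exchange_big mulr_sumr !big_seq; apply: eq_bigr => lam.
rewrite mem_partitions => lamk; have [sl _ _] := and3P lamk.
rewrite (psum_rem i.+1 (sort geq (i.+1 :: lam))) ?mem_sort ?mem_head//.
rewrite rem_sort_cons// psum_cons -mulr_suml -mulr_sumr !mulrA -exprD size_sort /=.
by congr (_ ^+ _ * _ / _); have := partition_size _ _ lamk; lia.
Qed.

(** Both sides obey the same Newton recursion and agree at k = 0. *)
Lemma elem_psum_exp N k (g : seq 'I_N -> R) : perm_invariant g -> elem k g = psum_exp k g.
Proof.
elim/ltn_ind: k g => -[|k] IH g gP.
  rewrite elem0 /psum_exp (perm_big _ partitions0) big_seq1 expr0 mul1r psum_nil.
  by rewrite /zee !big_nil mulr1 divr1.
apply: (@mulfI _ k.+1%:R); first by rewrite pnatr_eq0.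
rewrite elem_newton// psum_exp_newton// !big_nat; apply: eq_bigr => i /= ik.
congr (_ * _); apply: eq_bigr => j _; apply: IH; first by lia.
exact: (perm_invariant_cat g (nseq i.+1 j)) gP.
Qed.

(* A partition of [k] with [k - j] parts is a partition [p] of [j] with all
   parts increased by one, completed by parts equal to one. *)
Definition unexcess k j (p : seq nat) := map S p ++ nseq (k - j - size p) 1%N.

Lemma sumn_unexcess k j p : sumn p = j -> (j + size p <= k)%N ->
  sumn (unexcess k j p) = k.
Proof.
move=> pj pk; rewrite sumn_cat sumn_nseq.
have -> : sumn (map S p) = (sumn p + size p)%N.
  by elim: (p) => //= a q ->; lia.
by rewrite pj; lia.
Qed.

Lemma is_partition_unexcess k j p : is_partition j p -> (j + size p <= k)%N ->
  is_partition k (unexcess k j p).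
Proof.
move=> /and3P[sp p1 /eqP pj] pk; apply/and3P; split; last 2 first.
- rewrite all_cat all_nseq orbT andbT; apply/allP => _ /mapP[a _ ->] //.
- by apply/eqP; exact: sumn_unexcess.
rewrite /unexcess; elim: p sp {p1 pj pk} (k - j - size p)%N => [_ n|a p IH] /=.
  by case: n => //=; elim.
move=> ap n; have := IH (path_sorted ap) n.
case: p ap {IH} => [_|b p /= /andP[ab _] ->]; last by rewrite ltnS ab.
by case: n => //= n ->; rewrite ltnS andbT.
Qed.

Lemma size_unexcess k j p : (j + size p <= k)%N -> (size (unexcess k j p) = k - j)%N.
Proof. by rewrite size_cat size_map size_nseq; lia. Qed.

(** As [lam] is decreasing, its ones form a tail, and lowering every part by one leaves the total
    [k - size lam]. *)
Lemma unexcess_excess k lam : is_partition k lam ->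
  let p := map predn (seq.filter (ltn 1) lam) in
  let j := (k - size lam)%N in
  [/\ is_partition j p, (j + size p <= k)%N & unexcess k j p = lam].
Proof.
move=> lamk p j; have lk := partition_size _ _ lamk.
have [sl l1 /eqP sumk] := and3P lamk.
have pS : map S p = seq.filter (ltn 1) lam.
  rewrite -map_comp -[RHS]map_id; apply/eq_in_map => a /=.
  by rewrite mem_filter => /andP[/ltnW a1 _]; rewrite prednK.
have E : lam = map S p ++ nseq (size lam - size p) 1%N.
  rewrite -[size p](size_map S) pS {p pS j lk lamk sumk}.
  elim: lam sl l1 => // a lam IH al /= /andP[a1 l1].
  have [a2 /=|aa] := ltnP 1 a; first by rewrite subSS -IH ?(path_sorted al).
  have lam1 : all (pred1 1%N) lam.
    apply/allP => b bl; rewrite /= eqn_leq (allP l1 _ bl) andbT.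
    by rewrite (leq_trans _ aa)//; exact: (allP (order_path_min geq_trans al)).
  have -> : seq.filter (ltn 1) lam = [::].
    rewrite -(filter_pred0 lam); apply: eq_in_filter => b /(allP lam1)/eqP->//.
  rewrite subn0 /= -(all_pred1P _ _ lam1); congr (_ :: _).
  by apply/eqP; rewrite eqn_leq aa.
have sizep : (size p <= size lam)%N by rewrite size_map size_filter count_size.
have sumS q : sumn (map S q) = (sumn q + size q)%N.
  by elim: q => //= a q ->; lia.
have jp : sumn p = j.
  by move: sumk; rewrite {1}E sumn_cat sumS sumn_nseq mul1n /j; lia.
split.
- apply/and3P; split; last exact/eqP.
    have := sorted_filter geq_trans (ltn 1) sl.
    by rewrite -pS sorted_map; apply: sub_sorted.
  by apply/allP => _ /mapP[a + ->]; rewrite mem_filter => /andP[/= a1 _];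
    rewrite -ltnS prednK // ltnW.
- by rewrite /j; lia.
- by rewrite /unexcess [RHS]E; congr (_ ++ nseq _ _); rewrite /j; lia.
Qed.

Lemma unexcessK k j p : all (leq 1) p ->
  map predn (seq.filter (ltn 1) (unexcess k j p)) = p.
Proof.
move=> /allP p1; rewrite filter_cat filter_nseq /= cats0 filter_map -map_comp.
rewrite -[RHS]map_id (eq_in_filter (a2 := predT)) ?filter_predT.
  exact/eq_map.
by move=> a /p1 /=; rewrite ltnS.
Qed.

Lemma sum_partitions_excess k (F : seq nat -> R) : (0 < k)%N ->
  \sum_(lam <- partitions k) F lam = F (nseq k 1%N) +
    \sum_(1 <= j < k) \sum_(p : admissible k j) F (unexcess k j (parts (val p))).
Proof.
move=> k0.
(* Partitions are grouped by their excess j, which is less than k because k > 0 forces at least one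
   part; j = 0 leaves only the partition into ones. *)
transitivity (\sum_(0 <= j < k) \sum_(lam <- partitions k | (k - size lam)%N == j) F lam).
  rewrite (exchange_big_dep xpredT)//= !big_seq; apply: eq_bigr => lam.
  rewrite mem_partitions => lamk; rewrite big_mkord.
  have jk : (k - size lam < k)%N.
    have [_ _ /eqP sk] := and3P lamk.
    by case: (lam) sk => [|a l]; rewrite /= ?subn0; lia.
  by rewrite (big_pred1 (Ordinal jk)).
rewrite big_ltn//; congr (_ + _).
  rewrite -big_filter (perm_big [:: nseq k 1%N]) ?big_seq1//.
  apply: uniq_perm; rewrite ?filter_uniq ?partitions_uniq// => lam.
  rewrite mem_filter mem_partitions inE; apply/andP/eqP => [[/eqP s0 lamk]|->].
    have [/partition_size + _ <-] := unexcess_excess _ _ lamk.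
    by rewrite s0 leqn0 size_eq0 => /eqP->; rewrite /unexcess /= !subn0.
  have -> : nseq k 1%N = unexcess k 0 [::] by rewrite /unexcess /= !subn0.
  by rewrite is_partition_unexcess ?size_unexcess ?subn0 ?subnn.
rewrite !big_nat; apply: eq_bigr => j /andP[j0 jk].
rewrite -big_filter -[RHS]big_enum.
rewrite -(big_map (fun p : admissible k j => unexcess k j (parts (val p))) xpredT F).
apply: perm_big; apply: uniq_perm.
- by rewrite filter_uniq// partitions_uniq.
- rewrite map_inj_in_uniq ?enum_uniq// => p q _ _ pq.
  have /andP[/and3P[_ p1 _] _] := valP p.
  have /andP[/and3P[_ q1 _] _] := valP q.
  by apply/val_inj/parts_inj; rewrite -(unexcessK k j _ p1) pq unexcessK.
move=> lam; rewrite mem_filter mem_partitions; apply/andP/mapP => [[/eqP sj lamk]|[p _ ->]].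
  have [p1 p2 p3] := unexcess_excess _ _ lamk.
  rewrite sj in p1 p2 p3.
  have [p [pE _]] := parts_complete _ _ p1.
  have pP : is_partition j (parts p) && (j + size (parts p) <= k)%N by rewrite pE p1 p2.
  by exists (exist _ p pP); rewrite ?mem_enum//= pE p3.
have /andP[p1 p2] := valP p.
rewrite size_unexcess// is_partition_unexcess// subKn//; exact: ltnW.
Qed.

(** The successors of the parts of p are at least 2, so the multiplicity of 1 is the length of the
    padding and the other multiplicities are those of p. *)
Lemma zee_unexcess k j p : all (leq 1) p ->
  zee (unexcess k j p) = \prod_(q <- p) q.+1%:R *
    (\prod_(q <- undup p) (count_mem q p)`!%:R) * (k - j - size p)`!%:R :> R.
Proof.
move=> /allP p1; rewrite /zee.
rewrite (prod_count_undup _ (1%N :: map S (undup p))); last 2 first.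
- rewrite /= map_inj_uniq ?undup_uniq ?andbT; last exact: succn_inj.
  by apply/mapP => -[q]; rewrite mem_undup => /p1; case: q.
- move=> c; rewrite mem_cat inE => /orP[/mapP[q qp ->]|/nseqP[->]]; last by rewrite eqxx.
  by rewrite map_f ?orbT// mem_undup.
rewrite big_cons big_cat big_map [X in _ * X * _ = _]big_nseq iter_fix ?mulr1 ?mul1r;
  last exact: mulr1.
rewrite -mulrA; congr (_ * _); rewrite mulrC; congr (_ * _).
  rewrite big_map !big_seq; apply: eq_bigr => q; rewrite mem_undup => /p1 q1.
  rewrite count_cat count_map count_nseq /=.
  by case: q q1 => // q _; rewrite mul0n addn0.
rewrite count_cat count_map count_nseq /= mul1n.
rewrite (_ : count _ p = 0%N)//; apply/eqP; rewrite -leqn0 leqNgt -has_count.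
by apply/hasPn => q /p1; case: q.
Qed.

End newton_girard.

Section expansion.
Context {R : realType}.

(** For an admissible p, this identifies d_p^(k) as the number of permutations in S_k of cycle type
    [unexcess k j p]. *)
Lemma dcoefE k j p : all (leq 1) p ->
  dcoef k j p = k`!%:R / zee (unexcess k j p) :> R.
Proof.
by move=> p1; rewrite zee_unexcess// /dcoef !prodfV !invfM; ring.
Qed.

Lemma elem_expansion N k (g : seq 'I_N -> R) : (0 < k)%N -> perm_invariant g ->
  k`!%:R * elem k g = psum (nseq k 1%N) g +
    \sum_(1 <= j < k) (-1) ^+ j * \sum_(p : admissible k j)
      dcoef k j (parts (val p)) * psum (unexcess k j (parts (val p))) g.
Proof.
move=> k0 gP; rewrite elem_psum_exp// /psum_exp sum_partitions_excess// mulrDr.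
have n1 : nseq k 1%N = unexcess k 0 [::] by rewrite /unexcess /= !subn0.
congr (_ + _).
  rewrite n1 size_unexcess ?addn0// subn0 subnn expr0 mul1r zee_unexcess// !big_nil.
  by rewrite !mul1r /= !subn0 mulrCA mulfV ?mulr1// pnatr_eq0 -lt0n fact_gt0.
rewrite mulr_sumr !big_nat; apply: eq_bigr => j /andP[j0 jk].
rewrite !mulr_sumr; apply: eq_bigr => p _.
have /andP[/and3P[_ p1 _] p2] := valP p.
by rewrite dcoefE// size_unexcess// subKn ?(ltnW jk)//; ring.
Qed.

End expansion.

(** * Symmetrization of functions of words *)

Section symmetrization.
Context {R : numFieldType} {T : finType} (t0 : T) (k : nat).
Implicit Types (F : seq T -> R) (u v w : seq T) (t : 'S_k).

Definition shuffle t w := [seq nth t0 w (t i) | i <- enum 'I_k].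

(** The Newton-Girard identities require permutation invariance, which the indicator of a Borel set
    lacks in general. *)
Definition symmetrize F w : R :=
  if size w == k then k`!%:R^-1 * \sum_(t : 'S_k) F (shuffle t w) else 0.

Lemma size_shuffle t w : size (shuffle t w) = k.
Proof. by rewrite size_map size_enum_ord. Qed.

Lemma nth_shuffle t w (i : 'I_k) : nth t0 (shuffle t w) i = nth t0 w (t i).
Proof. by rewrite (nth_map i) ?size_enum_ord// nth_ord_enum. Qed.

Lemma shuffle_shuffle t t' w : shuffle t (shuffle t' w) = shuffle (t * t')%g w.
Proof. by apply/eq_map => i; rewrite nth_shuffle permM. Qed.

Lemma shuffle1 w : size w = k -> shuffle 1%g w = w.
Proof.
move=> wk; apply: (@eq_from_nth _ t0); rewrite size_shuffle// => i ik.
by rewrite (nth_shuffle _ _ (Ordinal ik)) perm1.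
Qed.

Lemma perm_eq_shuffle u v : size v = k -> perm_eq u v -> exists t, u = shuffle t v.
Proof.
move=> vk; have vk' : size v == k by apply/eqP.
move=> /(@tuple_permP _ _ _ (Tuple vk'))[t ->]; exists t.
by apply/eq_map => i; rewrite (tnth_nth t0).
Qed.

Lemma symmetrize_invariant F : perm_invariant (symmetrize F).
Proof.
move=> u v uv; rewrite /symmetrize (perm_size uv); case: eqP => // vk.
have [t ->] := perm_eq_shuffle _ _ vk uv.
congr (_ * _); rewrite [RHS](reindex_inj (mulIg t)) /=.
by apply: eq_bigr => t' _; rewrite shuffle_shuffle.
Qed.

Lemma mem_words1 w : (w \in words (nseq k 1%N)) = (size w == k).
Proof.
elim: k w => [|n IH] [|a w] //=.
  by apply/negbTE/negP => /allpairsP[[i v] []].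
apply/allpairsP/eqP => [[[i v] /= [_ + [_ ->]]]|[wn]].
  by rewrite IH => /eqP->.
by exists (a, w); rewrite /= IH wn mem_enum.
Qed.

Lemma words1_uniq : uniq (words (nseq k 1%N) : seq (seq T)).
Proof.
elim: k => //= n IH; apply: allpairs_uniq; rewrite ?enum_uniq//.
by move=> [a u] [b v] _ _ /= [-> ->].
Qed.

(** A shuffle of positions permutes the set of all words of length k; this is why F_{N,k} has no S_k
    in front of the k-fold tensor power. *)
Lemma psum_symmetrize1 F :
  psum (nseq k 1%N) (symmetrize F) = psum (nseq k 1%N) F.
Proof.
rewrite /psum; transitivity (\sum_(w <- words (nseq k 1%N))
    k`!%:R^-1 * \sum_(t : 'S_k) F (shuffle t w)).
  rewrite !big_seq; apply: eq_bigr => w; rewrite mem_words1 => wk.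
  by rewrite /symmetrize wk.
rewrite -mulr_sumr exchange_big /=.
rewrite (eq_bigr (fun=> \sum_(w <- words (nseq k 1%N)) F w)); last first.
  move=> t _.
  rewrite -(big_map (shuffle t) xpredT F); apply: perm_big; apply: uniq_perm.
  - rewrite map_inj_in_uniq ?words1_uniq// => u v.
    rewrite !mem_words1 => /eqP uk /eqP vk uv.
    by rewrite -[u]shuffle1// -[v]shuffle1// -(mulVg t) -!shuffle_shuffle uv.
  - exact: words1_uniq.
  move=> w; rewrite mem_words1; apply/mapP/eqP => [[v _ ->]|wk].
    exact: size_shuffle.
  exists (shuffle t^-1 w); first by rewrite mem_words1 size_shuffle.
  by rewrite shuffle_shuffle mulgV shuffle1.
by rewrite sumr_const card_Sn -[X in _ * X]mulr_natl mulrA mulVf ?mul1r// pnatr_eq0 -lt0n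
  fact_gt0.
Qed.

End symmetrization.

(** A shuffled injective prefix is again an injective word of length k, and by [prefix_sum_uniq] the
    sum over permutations is the same for all such words. *)
Lemma prefix_sum_symmetrize {R : numFieldType} {N k} (i0 : 'I_N) (F : seq 'I_N -> R) :
  (k <= N)%N -> prefix_sum k (symmetrize i0 k F) = prefix_sum k F.
Proof.
move=> kN; pose u := take k (enum 'I_N).
have uu : uniq u by rewrite take_uniq// enum_uniq.
have uk : size u = k by rewrite size_takel// size_enum_ord.
transitivity (\sum_(s : 'S_N) k`!%:R^-1 * \sum_(t : 'S_k) F (map s (shuffle i0 k t u))).
  apply: eq_bigr => s _; rewrite /symmetrize size_map uk eqxx.
  congr (_ * _); apply: eq_bigr => t _; congr F; rewrite -map_comp.
  by apply/eq_map => i /=; rewrite (nth_map i0)// uk.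
rewrite -mulr_sumr exchange_big /= (eq_bigr (fun=> prefix_sum k F)); last first.
  move=> t _.
  rewrite prefix_sum_uniq ?size_shuffle// map_inj_uniq ?enum_uniq// => i j /eqP.
  by rewrite nth_uniq ?uk// => /eqP/val_inj/perm_inj.
by rewrite sumr_const card_Sn -[X in _ * X]mulr_natl mulrA mulVf ?mul1r// pnatr_eq0 -lt0n
  fact_gt0.
Qed.

(** * Borel sets and integrals *)

Section borel.

Lemma continuous_powerP {Y X : topologicalType} {m} (f : Y -> power X m) :
  (forall i, continuous (fun y => f y i)) -> continuous f.
Proof.
move=> fc y; have FF := fmap_filter f (nbhs_filter y); apply/cvg_sup.
move=> i U [V [[W oW <-] /= Wy] WU].
have nW : nbhs (f y i) W by apply: open_nbhs_nbhs.
change (nbhs y (f @^-1` U)).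
by apply: (@filterS _ (nbhs y) _ ((fun z => f z i) @^-1` W)) (fc i y W nW) => z Wz;
  exact: WU.
Qed.

Lemma continuous_coord {X : topologicalType} {m} (i : 'I_m) :
  continuous (fun z : power X m => z i).
Proof. exact: (@proj_continuous _ (fun _ : 'I_m => X) i). Qed.

Lemma continuous_reindex {X : topologicalType} {m n} (h : 'I_n -> 'I_m) :
  continuous (fun z : power X m => (fun i => z (h i)) : power X n).
Proof. by apply: continuous_powerP => i; exact: continuous_coord. Qed.

Lemma borel_open {Y : ptopologicalType} (A : set Y) :
  open A -> measurable (A : set (borel Y)).
Proof. exact: sub_sigma_algebra. Qed.

Lemma measurable_borel {Y Z : ptopologicalType} (f : Y -> Z) : continuous f ->
  measurable_fun [set: borel Y] (f : borel Y -> borel Z).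
Proof.
move=> cf; apply: (@measurability _ _ (borel Y) (borel Z) setT f (@open Z)) => //.
move=> _ [B oB <-]; rewrite setTI; apply: borel_open.
by move/continuousP : cf; exact.
Qed.

Lemma measurable_borel_real {R : realType} {Y : ptopologicalType} (f : Y -> R) :
  continuous f -> measurable_fun [set: borel Y] (f : borel Y -> R).
Proof.
move=> cf; apply: (measurability _ (RGenOpens.measurableE R)).
move=> _ [_ [a [b ->] <-]]; rewrite setTI; apply: borel_open.
by move/continuousP : cf; apply; exact: interval_open.
Qed.

Lemma measurable_preimage {Y Z : ptopologicalType} (f : Y -> Z) (A : set (borel Z)) :
  continuous f -> measurable A -> measurable (f @^-1` A : set (borel Y)).
Proof. by move=> cf mA; rewrite -[X in measurable X]setTI; exact: measurable_borel. Qed.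

End borel.

Section integrals.
Context d (T : measurableType d) (R : realType).

Import HBNNSimple.

(* [m1] and [m2] need not be measures: the definition of the integral only
   evaluates them on the level sets of simple functions. *)
Lemma eq_meas_integral (m1 m2 : set T -> \bar R) (f : T -> \bar R) :
  m1 =mu m2 -> (\int[m1]_x f x = \int[m2]_x f x)%E.
Proof.
move=> m12; rewrite /integral.
have E (h : {nnsfun T >-> R}) : sintegral m1 h = sintegral m2 h.
  by rewrite /sintegral; apply: eq_fsbigr => r _; rewrite m12.
by congr (ereal_sup _ - ereal_sup _)%E; apply: eq_imagel => h _; rewrite E.
Qed.

Lemma empirical_ex (s : seq T) : (0 < size s)%N ->
  exists P : probability T R, forall A,
    P A = ((size s)%:R^-1 * \sum_(y <- s) \1_A y)%:E.
Proof.
move=> s0; pose y0 := head point s.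
have r0 : 0 <= (size s)%:R^-1 :> R by rewrite invr_ge0.
pose m := mscale (NngNum r0) (msum (fun i => dirac (nth y0 s i)) (size s)).
have mE A : m A = ((size s)%:R^-1 * \sum_(y <- s) \1_A y)%:E.
  rewrite /m /= /mscale /= /msum EFinM -sumEFin; congr (_ * _)%E.
  by rewrite (big_nth y0) big_mkord.
have mT : m setT = 1%E.
  rewrite mE; congr EFin; under eq_bigr do rewrite indicT.
  by rewrite big_const_seq count_predT iter_addr addr0 mulVf// pnatr_eq0 -lt0n.
pose P := HB.pack_for (probability T R) m (Measure_isProbability.Build _ _ _ m mT).
by exists P => A; rewrite -mE.
Qed.

Lemma conditional_ex (P : probability T R) (A : set T) : measurable A -> P A != 0%E ->
  exists Q : probability T R, forall B, Q B = (P (B `&` A) * (fine (P A))^-1%:E)%E.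
Proof.
move=> mA A0; exists (mnormalize (mrestr P mA) P) => B.
have PA : P (setT `&` A) = P A by rewrite setTI.
have PAoo : P A != +oo%E by rewrite -ltey ltey_eq fin_num_measure.
rewrite /= /mnormalize /=.
case: ifPn => [/orP[|]|_]; rewrite /mrestr /= PA ?(negbTE A0) ?(negbTE PAoo)//.
Qed.

Lemma pushforward_ex d' (T' : measurableType d') (P : probability T R) (f : T -> T') :
  measurable_fun setT f -> exists Q : probability T' R, forall B, Q B = P (f @^-1` B).
Proof.
move=> mf; pose X := HB.pack_for {mfun T >-> T'} f (isMeasurableFun.Build _ _ _ _ f mf).
by exists (distribution P X).
Qed.

End integrals.

(** * The measures tensor, blocks and Fmeas at an empirical measure *)

Section atomic.
Context {R : realType}.

(** Bare set functions are allowed because [tensor] and [blocks] are not packaged as measures. *)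
Definition atomic {d} {T : measurableType d} (mu : set T -> \bar R) (w : R) (s : seq T) :=
  forall A, measurable A -> mu A = (w * \sum_(y <- s) \1_A y)%:E.

Lemma integral_atomic d (T : measurableType d) (mu : set T -> \bar R) w s (f : T -> R) :
  0 <= w -> atomic mu w s -> measurable_fun setT f -> (forall y, 0 <= f y) ->
  (\int[mu]_y (f y)%:E = (w * \sum_(y <- s) f y)%:E)%E.
Proof.
move=> w0 muE mf f0; pose y0 := head point s.
pose m := mscale (NngNum w0) (msum (fun i => dirac (nth y0 s i)) (size s)).
have mE : mu =mu m.
  move=> A mA; rewrite muE// /m /= /mscale /= /msum EFinM -sumEFin; congr (_ * _)%E.
  by rewrite (big_nth y0) big_mkord.
have mf' : measurable_fun setT (EFin \o f) by exact/measurable_EFinP.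
rewrite (eq_meas_integral _ _ _ _ _ _ mE) ge0_integral_mscale//; last first.
  by move=> y _; rewrite lee_fin.
rewrite EFinM; congr (_ * _)%E.
rewrite ge0_integral_measure_sum//; last by move=> y _; rewrite lee_fin.
rewrite -sumEFin (big_nth y0) big_mkord; apply: eq_bigr => i _.
by rewrite integral_dirac// diracT mul1e.
Qed.

End atomic.

Section blocks.
Context {R : realType} {X : ptopologicalType}.
Notation mfun m := (set (borel (power X m)) -> \bar R).

Lemma continuous_concat_l {a b} (z : power X b) :
  continuous (fun y : power X a => concat (y, z) : power X (a + b)).
Proof.
apply: continuous_powerP => i; rewrite /concat; case: fintype.split => j /=.
  exact: continuous_coord.
exact: cst_continuous.
Qed.

Lemma continuous_concat_r {a b} (y : power X a) :
  continuous (fun z : power X b => concat (y, z) : power X (a + b)).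
Proof.
apply: continuous_powerP => i; rewrite /concat; case: fintype.split => j /=.
  exact: cst_continuous.
exact: continuous_coord.
Qed.

(** As [nu] is atomic, the mass of a section is a finite sum of indicators; continuity of [concat]
    in each variable separately makes the sections and their masses measurable. *)
Lemma atomic_tensor {a b} (mu : mfun a) (nu : mfun b) v w s t :
  0 <= v -> 0 <= w -> atomic mu v s -> atomic nu w t ->
  atomic (tensor mu nu) (v * w) [seq concat (y, z) | y <- s, z <- t].
Proof.
move=> v0 w0 muE nuE A mA; rewrite /tensor /pushforward /product_measure1.
transitivity (\int[mu]_y (w * \sum_(z <- t) \1_A (concat (y, z)))%:E)%E.
  congr (integral _ _ _); apply/funext => y /=; rewrite nuE.
    congr (_ * _)%:E; apply: eq_bigr => z _.
    by rewrite !indicE; congr ((_ : bool)%:R); apply/idP/idP; rewrite mem_xsection !inE.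
  rewrite (_ : xsection _ _ = (fun z => concat (y, z)) @^-1` A).
    exact: measurable_preimage (continuous_concat_r y) mA.
  by apply/seteqP; split => z /=; rewrite /xsection /= inE.
rewrite (integral_atomic _ _ _ _ _ (fun y =>
  w * \sum_(z <- t) \1_A (concat (y, z))) v0 muE).
- by rewrite -mulr_sumr mulrA big_allpairs_dep.
- apply: measurable_funM => //.
  apply: measurable_sum => z.
  exact: measurable_indic (measurable_preimage _ A (continuous_concat_l z) mA).
- by move=> y; rewrite mulr_ge0// sumr_ge0.
Qed.

Context {N : nat} (x : 'I_N -> X) (i0 : 'I_N) (la : set (borel X) -> \bar R).
Hypothesis laE : la =mu (fun A => (N%:R^-1)%:E * \sum_(i < N) dirac (x i : borel X) A)%E.

Definition point_of m (w : seq 'I_N) : borel (power X m) := fun i => x (nth i0 w i).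

Lemma atomic_id_push m : atomic (id_push la m : mfun m) N%:R^-1
  [seq (fun _ => x i) : borel (power X m) | i <- enum 'I_N].
Proof.
move=> A mA; rewrite /id_push /pushforward laE.
  rewrite EFinM -sumEFin; congr (_ * _)%E.
  by rewrite big_map big_enum; apply: eq_bigr => i _; rewrite diracE indicE.
apply: measurable_preimage mA.
by apply: continuous_powerP => i y; exact: cvg_id.
Qed.

Lemma concat_point_of c m j w :
  concat ((fun _ => x j) : borel (power X c),
    point_of m w) = point_of (c + m) (nseq c j ++ w).
Proof.
apply/funext => i; rewrite /concat /point_of nth_cat size_nseq.
case: fintype.splitP => u -> /=; first by rewrite nth_nseq ltn_ord.
by rewrite addKn.
Qed.

Lemma atomic_cons c lam m (mu : mfun m) w : 0 <= w ->
  atomic mu w [seq point_of m v | v <- words lam] ->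
  atomic (tensor (id_push la c) mu) (N%:R^-1 * w)
    [seq point_of (c + m) v | v <- words (c :: lam)].
Proof.
move=> w0 muE A mA.
rewrite (atomic_tensor _ _ _ _ _ _ _ w0 (atomic_id_push c) muE)// ?invr_ge0//.
congr (_ * _)%:E; rewrite big_allpairs_dep /= big_map big_enum.
rewrite big_map big_allpairs_dep big_enum; apply: eq_bigr => i _.
by rewrite big_map; apply: eq_bigr => v _; rewrite concat_point_of.
Qed.

(** Every tensor factor contributes one constant block of letters and one weight 1 / N, so the
    exponent counts factors rather than coordinates. *)
Lemma atomic_blocks p m : atomic (blocks la p m) (N%:R^-1 ^+ (size p + m))
  [seq point_of (tdim p m) v | v <- words (map S p ++ nseq m 1%N)].
Proof.
have w0 n : 0 <= N%:R^-1 ^+ n :> R by rewrite exprn_ge0 ?invr_ge0.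
elim: p => [|q p IH]; last first.
  by rewrite [_ ^+ _]exprS; exact: (atomic_cons q.+1 _ _ _ _ (w0 _) IH).
elim: m => [A mA|m IH].
  rewrite /= expr0 mul1r big_seq1 diracE indicE; suff -> : point = point_of 0 [::] by [].
  by apply/funext => -[].
by rewrite [_ ^+ _]exprS; exact: (atomic_cons 1 (nseq m 1%N) m (tpower la m) _ (w0 _) IH).
Qed.

End blocks.

(** * The formula F_{N,k} at an empirical measure *)

Section explicit_formula.
Context {R : realType} {X : ptopologicalType} {N k : nat} (hkN : (k <= N)%N).
Context (x : 'I_N -> X).

(** The mass that M_k S_N delta_x gives to A, as a real number. *)
Definition orbit_mean (A : set (borel (power X k))) : R :=
  N`!%:R^-1 * \sum_(s : 'S_N) \1_A ((fun i => x (s (widen_ord hkN i))) : borel (power X k)).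

Lemma marginal_symm_dirac (A : set (borel (power X k))) :
  marginal hkN (symm (dirac (x : borel (power X N)))) A = (orbit_mean A)%:E.
Proof.
rewrite /marginal /pushforward /symm EFinM -sumEFin.
by congr (_ * _)%E.
Qed.

Context (i0 : 'I_N) (la : set (borel X) -> \bar R).
Hypothesis laE : la =mu (fun A => (N%:R^-1)%:E * \sum_(i < N) dirac (x i : borel X) A)%E.

Definition indic_word (A : set (borel (power X k))) (w : seq 'I_N) : R :=
  \1_A (point_of x i0 k w).

Lemma tpower_words A : measurable A ->
  tpower la k A = (N%:R^-1 ^+ k * psum (nseq k 1%N) (indic_word A))%:E.
Proof. by move=> mA; rewrite -[tpower la k]/(blocks la [::] k) (atomic_blocks x i0 la laE
  [::] k A mA) big_map. Qed.

(** A partition of j with n parts gives n + (k - j - n) = k - j tensor factors, so all partitions of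
    j carry the same weight. *)
Lemma Pmeas_words j (A : set (borel (power X k))) : (j <= k)%N -> measurable A ->
  Pmeas k j la A = (N%:R^-1 ^+ (k - j) * \sum_(p : admissible k j)
    dcoef k j (parts (val p)) * psum (unexcess k j (parts (val p))) (indic_word A))%:E.
Proof.
move=> jk mA; rewrite /Pmeas mulr_sumr -sumEFin; apply: eq_bigr => p _.
rewrite /recast /pushforward (atomic_blocks x i0 la laE); last first.
  exact: measurable_preimage (continuous_reindex _) mA.
rewrite -EFinM mulrCA; congr (_ * (_ * _))%:E; last by rewrite big_map.
by have /andP[_ pk] := valP p; congr (_ ^+ _); rewrite subnKC// leq_subRL.
Qed.

Lemma symm_Pmeas_words j (A : set (borel (power X k))) : (j <= k)%N -> measurable A ->
  symm (Pmeas k j la) A = (N%:R^-1 ^+ (k - j) * \sum_(p : admissible k j)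
    dcoef k j (parts (val p)) * psum (unexcess k j (parts (val p)))
      (symmetrize i0 k (indic_word A)))%:E.
Proof.
move=> jk mA; rewrite /symm.
under eq_bigr => s _.
  rewrite /permute /pushforward Pmeas_words//; last first.
    exact: measurable_preimage (continuous_reindex _) mA.
  over.
rewrite sumEFin -EFinM -mulr_sumr mulrCA; congr (_ * _)%:E.
rewrite exchange_big mulr_sumr; apply: eq_bigr => p _.
rewrite -mulr_sumr mulrCA; congr (_ * _); rewrite /psum exchange_big mulr_sumr !big_seq.
apply: eq_bigr => w /size_words wk.
have /andP[/and3P[_ p1 /eqP pj] pk] := valP p.
rewrite /symmetrize wk sumn_unexcess// eqxx; congr (_ * _); apply: eq_bigr => t _.
have shE : point_of x i0 k (shuffle i0 k t w) = (fun i => point_of x i0 k w (t i)).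
  by apply/funext => i; rewrite /point_of nth_shuffle.
by rewrite /indic_word shE !indicE.
Qed.

(** With G the symmetrized indicator of A, the bracket in F_{N,k} is N^-k k! e_k(G) by
    [elem_expansion]. The prefactor equals N^k / [N ^_ k] and cancels the normalisation in [elem],
    leaving the average over S_N. *)
Lemma Fmeas_symm_dirac : (0 < k)%N ->
  Fmeas N k la =mu marginal hkN (symm (dirac (x : borel (power X N)))).
Proof.
move=> k0 A mA; have N0 : (0 < N)%N by exact: leq_trans hkN.
rewrite marginal_symm_dirac /Fmeas tpower_words//.
pose G := symmetrize i0 k (indic_word A).
have -> : \sum_(1 <= j < k) (((-1) ^+ j / N%:R ^+ j)%:E * symm (Pmeas k j la) A)%E =
    (N%:R^-1 ^+ k * \sum_(1 <= j < k) (-1) ^+ j * \sum_(p : admissible k j)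
    dcoef k j (parts (val p)) * psum (unexcess k j (parts (val p))) G)%:E.
  rewrite mulr_sumr -sumEFin !big_nat; apply: eq_bigr => j /andP[j1 jk].
  rewrite symm_Pmeas_words ?(ltnW jk)// -EFinM; congr EFin.
  have -> : N%:R^-1 ^+ k = N%:R^-1 ^+ j * N%:R^-1 ^+ (k - j) :> R.
    by rewrite -exprD subnKC// ltnW.
  by rewrite -/G -exprVn; ring.
rewrite -EFinD -EFinM -(psum_symmetrize1 i0) -/G -mulrDr -elem_expansion//; last first.
  exact: symmetrize_invariant.
rewrite /elem /G prefix_sum_symmetrize//; congr EFin.
have -> : prefix_sum k (indic_word A) =
    \sum_(s : 'S_N) \1_A ((fun i => x (s (widen_ord hkN i))) : borel (power X k)).
  apply: eq_bigr => s _; rewrite /indic_word; congr (\1_A _).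
  apply/funext => i; rewrite /point_of; congr x.
  have ik : (i < size (take k (enum 'I_N)))%N by rewrite size_takel ?size_enum_ord.
  rewrite (nth_map i0)// nth_take//; congr (s _); apply: val_inj => /=.
  by rewrite nth_enum_ord// (leq_trans _ hkN).
have -> : (N ^_ k)%:R = N%:R * \prod_(1 <= i < k) (N%:R - i%:R) :> R.
  rewrite ffact_prod natr_prod -(big_mkord xpredT (fun i => (N - i)%:R : R)) big_ltn//.
  rewrite subn0; congr (_ * _); rewrite !big_nat; apply: eq_bigr => i /andP[_ ik].
  by rewrite natrB// (leq_trans (ltnW ik)).
have h1 : N%:R != 0 :> R by rewrite pnatr_eq0 -lt0n.
have h2 : \prod_(1 <= i < k) (N%:R - i%:R) != 0 :> R.
  rewrite prodf_seq_neq0; apply/allP => i; rewrite mem_index_iota => /andP[_ ik] /=.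
  by rewrite subr_eq0 eqr_nat neq_ltn (leq_trans ik hkN) orbT.
have h3 n : n`!%:R != 0 :> R by rewrite pnatr_eq0 -lt0n fact_gt0.
rewrite -{1 3}(prednK k0) exprS exprVn /orbit_mean.
have h4 := expf_neq0 k.-1 h1; move: (h3 N) (h3 k) => h5 h6.
move: h1 h2 h4 h5 h6; rewrite [k.-1.+1.-1]/=.
set a := _ ^+ _; set b := (\prod_(_ <= _ < _) _) => h1 h2 h4 h5 h6.
by field; rewrite h1 h2 h4 h5 h6.
Qed.

End explicit_formula.

(** * A countable pi-system *)

Section second_countable.
Context {R : realType} {X : ptopologicalType} (hX : polish R X) (k : nat).

Lemma dense_sequence : exists f : nat -> X,
  forall A : set X, open A -> A !=set0 -> exists n, A (f n).
Proof.
have [[D cD dD] _] := hX; have [g ginj] := elimT (countable_injP D) cD.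
(* The sequence inverts the injection [g] on [D]; integers outside the image are sent to [point]. *)
exists (fun n => xget point [set a | D a /\ g a = n]) => A oA A0.
have [a [Aa Da]] := dD _ A0 oA; exists (g a).
case: xgetP => [b _ [Db gba]|/(_ a)]; last by case.
by rewrite (ginj b a) ?inE.
Qed.

(** The sets are finite intersections of boxes with centres in a dense sequence and radii 1 / (n +
    1). These boxes form a countable base of the product topology, so each open set is a countable
    union of them. *)
Lemma countable_pi_base : exists V : nat -> set (borel (power X k)),
  [/\ forall n, measurable (V n), setI_closed (range V), exists n, V n = setT
    & @measurable _ (borel (power X k)) = <<s range V >>].
Proof.
have [f fP] := dense_sequence.
have [_ [d [[d0 dE] [dC dT] dN _]]] := hX.
have ball_nbhs (a b : X) r : d a b < r -> nbhs b [set c | d a c < r].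
  move=> abr; apply/dN; exists (r - d a b); first by rewrite subr_gt0.
  by move=> c /= bc; have := dT a b c; lra.
have ball_open (a : X) r : open [set c | d a c < r].
  by rewrite openE => b /= abr; exact: ball_nbhs.
pose box (b : {ffun 'I_k -> nat} * nat) : set (power X k) :=
  [set z | forall i, d (f (b.1 i)) (z i) < b.2.+1%:R^-1].
have box_open b : open (box b).
  rewrite openE => z zb.
  apply: (@filter_forall _ _ (fun i w => d (f (b.1 i)) (w i) < b.2.+1%:R^-1) (nbhs z)).
  move=> i.
  exact: (continuous_coord i z _ (ball_nbhs _ _ _ (zb i))).
have box_small (z : power X k) (O : set (power X k)) : nbhs z O ->
    exists2 b, box b z & box b `<=` O.
  move=> zO.
  (* The filter of uniform balls around z; its convergence to z says that every neighbourhood of z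
     contains such a ball. *)
  pose F := filter_from [set e : R | 0 < e]
    (fun e => [set w : power X k | forall i, d (z i) (w i) < e]).
  have FF : Filter F.
    apply: filter_from_filter; first by exists 1; exact: ltr01.
    move=> e1 e2 /= e10 e20; exists (Num.min e1 e2); first by rewrite /= lt_min e10.
    by move=> w /= zw; split => i; have := zw i; rewrite lt_min => /andP[].
  have Fz : F --> z.
    apply/cvg_sup => i U [W [[W' oW <-] /= Wz] WU].
    have /dN[e e0 eW] : nbhs (z i) W' by apply: open_nbhs_nbhs.
    by exists e => // w /= zw; apply: WU; apply: eW; exact: zw.
  have [e /= e0 eO] := Fz _ zO.
  have [n ne] : exists n, n.+1%:R^-1 < e / 2.
    exists (Num.truncn (e / 2)^-1); rewrite invf_plt ?posrE ?divr_gt0//.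
    exact: Num.Theory.truncnS_gt.
  have /choice[t tP] (i : 'I_k) : exists m, d (z i) (f m) < n.+1%:R^-1.
    apply: (fP [set c | d (z i) c < n.+1%:R^-1]) => //.
    by exists (z i); rewrite /= (dE _ _).2// invr_gt0.
  exists ([ffun i => t i], n) => [i /=|w /= wb].
    by rewrite ffunE dC.
  apply: eO => i; have := wb i; rewrite /= ffunE.
  move: (dT (z i) (f (t i)) (w i)) (tP i) ne; set r := n.+1%:R^-1; lra.
pose U (l : seq ({ffun 'I_k -> nat} * nat)) : set (borel (power X k)) :=
  [set z | forall b, b \in l -> box b z].
(* Integers that code no list are sent to the empty list, that is, to the whole space. *)
pose V n := U (odflt [::] (unpickle n)).
have VU l : V (pickle l) = U l by rewrite /V pickleK.
have U0 : U [::] = setT by apply/seteqP; split.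
have Ucons b l : U (b :: l) = box b `&` U l.
  apply/seteqP; split => z /= => [zU|[zb zl] c].
    by split=> [|c cl]; apply: zU; rewrite inE ?eqxx ?cl ?orbT.
  by rewrite inE => /predU1P[->//|]; exact: zl.
have mU l : measurable (U l).
  elim: l => [|b l IH]; first by rewrite U0.
  by rewrite Ucons; apply: measurableI => //; exact: borel_open.
exists V; split => //.
- by move=> n; exact: mU.
- move=> _ _ [m _ <-] [n _ <-]; rewrite /V; set l1 := odflt _ _; set l2 := odflt _ _.
  exists (pickle (l1 ++ l2)) => //; rewrite -/(V _) VU.
  apply/seteqP; split => z /= => [zU|[z1 z2] b].
    by split => b bl; apply: zU; rewrite mem_cat bl ?orbT.
  by rewrite mem_cat => /orP[]; [exact: z1|exact: z2].
- by exists (pickle ([::] : seq ({ffun 'I_k -> nat} * nat))); rewrite VU.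
rewrite eqEsubset; split; last first.
  by apply: smallest_sub; [exact: sigma_algebra_measurable|move=> _ [n _ <-]; exact: mU].
apply: smallest_sub; first exact: smallest_sigma_algebra.
move=> O oO.
have -> : O = \bigcup_n (if `[< V n `<=` O >] then V n else set0).
  apply/seteqP; split => z; last by move=> [n _]; case: asboolP => [VO /VO|].
  move=> Oz; have [b zb bO] := box_small z O (open_nbhs_nbhs (conj oO Oz)).
  have UbE : U [:: b] = box b by rewrite Ucons U0 setIT.
  exists (pickle [:: b]) => //; rewrite VU UbE; case: asboolP => //.
apply: (@bigcupT_measurable _ (g_sigma_algebraType (range V))) => n.
case: ifP => _ //.
by apply: sub_sigma_algebra; exists n.
Qed.

End second_countable.

(** * Symmetric measures and extreme points *)

Lemma EFin_mulfI (R : realType) (a : R) (x y : \bar R) : a != 0 ->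
  (a%:E * x = a%:E * y)%E -> x = y.
Proof.
move=> a0 /(congr1 (fun z => a^-1%:E * z)%E).
by rewrite !muleA -!EFinM mulVf// !mul1e.
Qed.

Section symmetric_measures.
Context {R : realType} {X : ptopologicalType} {N : nat}.

Definition rearrange (s : 'S_N) (y : borel (power X N)) : borel (power X N) :=
  fun i => y (s i).

Lemma rearrangeM s t y : rearrange s (rearrange t y) = rearrange (s * t)%g y.
Proof. by apply/funext => i; rewrite /rearrange permM. Qed.

Lemma measurable_rearrange s : measurable_fun setT (rearrange s).
Proof. by apply: measurable_borel; exact: continuous_reindex. Qed.

Lemma measurable_rearrange_preimage s (A : set (borel (power X N))) :
  measurable A -> measurable (rearrange s @^-1` A).
Proof. by apply: measurable_preimage; exact: continuous_reindex. Qed.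

Lemma symm_invariant (gam : probability (borel (power X N)) R) s
    (A : set (borel (power X N))) :
  symm gam =mu gam -> measurable A -> gam (rearrange s @^-1` A) = gam A.
Proof.
move=> gamS mA; rewrite -[RHS]gamS// -[LHS]gamS; last exact: measurable_rearrange_preimage.
congr (_ * _)%E; rewrite [RHS](reindex_inj (mulgI s)); apply: eq_bigr => t _ /=.
rewrite /permute /pushforward -/(rearrange t) -/(rearrange (s * t)%g); congr (gam _).
by rewrite (_ : rearrange (s * t)%g = rearrange s \o rearrange t)//; apply/funext => y;
  rewrite /= rearrangeM.
Qed.

Lemma invariant_symm (gam : probability (borel (power X N)) R) :
  (forall s (A : set (borel (power X N))),
    measurable A -> gam (rearrange s @^-1` A) = gam A) ->
  symm gam =mu gam.
Proof.
move=> gamI A mA; rewrite /symm.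
under eq_bigr => s _ do rewrite /permute /pushforward -/(rearrange s) gamI//.
have /fineK <- : gam A \is a fin_num by rewrite fin_num_measure.
by rewrite sumEFin -EFinM sumr_const card_Sn -[X in _ * X]mulr_natl mulrA mulVf ?mul1r//.
Qed.

(** By invariance each of the N! terms on the right has the same integral as [u]. *)
Lemma symm_integral (gam : probability (borel (power X N)) R) (u : power X N -> R) :
  symm gam =mu gam -> measurable_fun [set: borel (power X N)] u -> (forall y, 0 <= u y) ->
  (N`!%:R%:E * \int[gam]_y (u y)%:E = \int[gam]_y (\sum_(s : 'S_N) u (rearrange s y))%:E)%E.
Proof.
move=> gamS mu_ u0.
have mue : measurable_fun [set: borel (power X N)] (EFin \o u) by exact/measurable_EFinP.
under [in RHS]eq_integral do rewrite -sumEFin.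
rewrite ge0_integral_sum//; last 2 first.
- move=> s; apply/measurable_EFinP.
  exact: measurableT_comp mu_ (measurable_rearrange s).
- by move=> s y _; rewrite lee_fin.
rewrite (eq_bigr (fun=> \int[gam]_y (u y)%:E)%E); last first.
  move=> s _; rewrite -(ge0_integral_pushforward (measurable_rearrange s) gam measurableT
    mue).
    by apply: eq_meas_integral => A mA; exact: symm_invariant.
  by move=> y _; rewrite lee_fin.
by rewrite sumr_const card_Sn mule_natl.
Qed.

Lemma ae_eq_integral_cst d (T : measurableType d) (P : probability T R) (f : T -> R) c :
  measurable_fun setT f -> {ae P, forall y, f y = c} -> (\int[P]_y (f y)%:E = c%:E)%E.
Proof.
move=> mf fc; rewrite (ae_eq_integral (cst c%:E))//.
- by rewrite integral_cst// [X in (_ * X)%E]probability_setT mule1.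
- exact/measurable_EFinP.
- by apply: filterS fc => y -> _.
Qed.

Context {k : nat} (hkN : (k <= N)%N).

Definition restr (y : borel (power X N)) : borel (power X k) :=
  fun i => y (widen_ord hkN i).

Lemma measurable_restr : measurable_fun setT restr.
Proof. by apply: measurable_borel; exact: continuous_reindex. Qed.

Lemma measurable_restr_preimage (B : set (borel (power X k))) :
  measurable B -> measurable (restr @^-1` B).
Proof. by apply: measurable_preimage; exact: continuous_reindex. Qed.

Lemma orbit_meanE (y : borel (power X N)) (B : set (borel (power X k))) :
  orbit_mean hkN y B = N`!%:R^-1 * \sum_(s : 'S_N) \1_(restr @^-1` B) (rearrange s y) :> R.
Proof. by []. Qed.

Lemma orbit_mean_rearrange s (y : borel (power X N)) (B : set (borel (power X k))) :
  orbit_mean hkN (rearrange s y) B = orbit_mean hkN y B :> R.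
Proof.
rewrite !orbit_meanE; congr (_ * _); rewrite [RHS](reindex_inj (mulIg s)) /=.
by apply: eq_bigr => t _; rewrite rearrangeM.
Qed.

Lemma measurable_orbit_sum (B : set (borel (power X k))) : measurable B ->
  measurable_fun [set: borel (power X N)]
    (fun y => \sum_(s : 'S_N) \1_(restr @^-1` B) (rearrange s y) : R).
Proof.
move=> mB; apply: measurable_sum => s.
have mi := measurable_indic (R := R) (D := setT) (measurable_restr_preimage _ mB).
exact: measurableT_comp mi (measurable_rearrange s).
Qed.

(** For symmetric [gam] the marginal mass of B is the [gam]-mean of [orbit_mean]. This serves twice:
    to identify extreme points, and to treat equality in the exposing inequality. *)
Lemma marginal_ae (gam : probability (borel (power X N)) R)
    (B : set (borel (power X k))) v :
  symm gam =mu gam -> measurable B -> {ae gam, forall y, orbit_mean hkN y B = v} ->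
  gam (restr @^-1` B) = v%:E.
Proof.
move=> gamS mB aev; have mB' := measurable_restr_preimage _ mB.
have f0 : N`!%:R != 0 :> R by rewrite pnatr_eq0 -lt0n fact_gt0.
have i0 y : 0 <= \1_(restr @^-1` B) y :> R by rewrite indicE.
have := symm_integral gam (\1_(restr @^-1` B)) gamS (measurable_indic mB') i0.
rewrite integral_indic// setIT (ae_eq_integral_cst _ _ _ _ (N`!%:R * v)).
- by rewrite EFinM; exact: EFin_mulfI.
- exact: measurable_orbit_sum.
- by apply: (@filterS _ _ (ae_filter_ringOfSetsType gam)) aev => y;
  rewrite orbit_meanE => <-; rewrite mulrA mulfV ?mul1r.
Qed.

End symmetric_measures.

(** * Conditioning on symmetric sets *)

Section extreme.
Context {R : realType} {X : ptopologicalType} {N k : nat} (hkN : (k <= N)%N).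

Lemma orbit_mean_ex (y : borel (power X N)) : exists P : probability (borel (power X k)) R,
  forall B, P B = (orbit_mean hkN y B)%:E.
Proof.
have [|P PE] := @empirical_ex _ (borel (power X k)) R
    [seq restr hkN (rearrange s y) | s <- enum [set: 'S_N]%SET].
  by rewrite size_map -cardE cardsT card_Sn fact_gt0.
exists P => B; rewrite PE size_map -cardE cardsT card_Sn big_map big_enum /=.
by congr (_ * _)%:E; apply: eq_bigl => s; rewrite inE.
Qed.

Lemma symm_dirac_ex (y : borel (power X N)) : exists P : probability (borel (power X N)) R,
  [/\ symm P =mu P, atomic P N`!%:R^-1 [seq rearrange s y | s <- enum [set: 'S_N]%SET]
    & forall B, P (restr hkN @^-1` B) = (orbit_mean hkN y B)%:E].
Proof.
have [|P PE] := @empirical_ex _ (borel (power X N)) R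
    [seq rearrange s y | s <- enum [set: 'S_N]%SET].
  by rewrite size_map -cardE cardsT card_Sn fact_gt0.
have PE' A : P A = (N`!%:R^-1 * \sum_(s : 'S_N) \1_A (rearrange s y))%:E.
  rewrite PE size_map -cardE cardsT card_Sn big_map big_enum /=.
  by congr (_ * _)%:E; apply: eq_bigl => s; rewrite inE.
exists P; split.
- apply: invariant_symm => s A mA; rewrite !PE'; congr (_ * _)%:E.
  rewrite [RHS](reindex_inj (mulgI s)); apply: eq_bigr => t _ /=.
  by rewrite -rearrangeM !indicE.
- by move=> A mA; rewrite PE size_map -cardE cardsT card_Sn.
- by move=> B; rewrite PE' orbit_meanE.
Qed.

Lemma conditional_symm (gam Q : probability (borel (power X N)) R)
    (A : set (borel (power X N))) :
  symm gam =mu gam -> measurable A -> (forall s, rearrange s @^-1` A = A) ->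
  (forall B, Q B = (gam (B `&` A) * (fine (gam A))^-1%:E)%E) -> symm Q =mu Q.
Proof.
move=> gamS mA AS QE; apply: invariant_symm => s B mB; rewrite !QE; congr (_ * _)%E.
rewrite -{1}(AS s) -preimage_setI symm_invariant//.
exact: measurableI.
Qed.

Lemma Nrep_marginal (gam : probability (borel (power X N)) R) : symm gam =mu gam ->
  exists2 nu : probability (borel (power X k)) R, Nrep hkN nu &
    forall B, nu B = gam (restr hkN @^-1` B).
Proof.
move=> gamS; have [nu nuE] := pushforward_ex _ _ _ _ _ gam _ (measurable_restr hkN).
by exists nu => //; exists gam; split => // B _; rewrite nuE.
Qed.

(** With t = gam A, conditioning on A and on its complement writes [mu] as t M_k Q1 + (1 - t) M_k
    Q2, both marginals being N-representable since A is symmetric; extremality gives M_k Q1 = mu. *)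
Lemma extreme_conditional (mu : probability (borel (power X k)) R)
    (gam : probability (borel (power X N)) R) (A : set (borel (power X N))) :
  extreme_points (Nrep hkN) mu -> symm gam =mu gam -> mu =mu marginal hkN gam ->
  measurable A -> (forall s, rearrange s @^-1` A = A) -> gam A != 0%E ->
  exists Q : probability (borel (power X N)) R, [/\ symm Q =mu Q, Q A = 1%E
    & forall B, measurable B -> Q (restr hkN @^-1` B) = mu B].
Proof.
move=> [_ muX] gamS muE mA AS A0.
have gC := probability_setC gam mA.
(* If the complement is null there is no proper convex combination, and [gam] itself has the
   required properties. *)
have [C0|C0] := eqVneq (gam (~` A)) 0%E.
  exists gam; split => //; last by move=> B mB; rewrite muE.
  by rewrite -[A]setCK probability_setC ?C0 ?sube0//; exact: measurableC.
have [Q1 Q1E] := conditional_ex _ _ _ gam _ mA A0.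
have [Q2 Q2E] := conditional_ex _ _ _ gam _ (measurableC mA) C0.
have Q1S := conditional_symm _ _ _ gamS mA AS Q1E.
have CS s : rearrange s @^-1` (~` A) = ~` A by rewrite -[in RHS](AS s) preimage_setC.
have Q2S := conditional_symm _ _ _ gamS (measurableC mA) CS Q2E.
have [nu1 nu1R nu1E] := Nrep_marginal Q1 Q1S.
have [nu2 nu2R nu2E] := Nrep_marginal Q2 Q2S.
have fA : gam A \is a fin_num by rewrite fin_num_measure.
pose t := fine (gam A); have tE : gam A = t%:E by rewrite fineK.
have CE : gam (~` A) = (1 - t)%:E by rewrite gC tE.
have t0 : 0 < t by rewrite lt_def fine_ge0// andbT fine_eq0.
have t1 : 0 < 1 - t.
  by rewrite lt_def -lee_fin -CE measure_ge0 andbT -eqe -CE.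
have t01 : 0 < t < 1 by rewrite t0 -subr_gt0.
have [|nu1mu _] := muX nu1 nu2 t nu1R nu2R t01.
  move=> B mB; have mB' := measurable_restr_preimage hkN _ mB.
  rewrite muE// nu1E nu2E Q1E Q2E tE CE /=.
  rewrite ![(_ * (_^-1)%:E)%E]muleC !muleA -!EFinM !mulfV ?gt_eqF// !mul1e.
  rewrite /marginal /pushforward -/(restr hkN) -[X in gam X = _]setIT -(setUv A) setIUr.
  rewrite measureU//; first exact: measurableI.
    by apply: measurableI => //; exact: measurableC.
  by rewrite setIACA setICr setI0.
exists Q1; split => //.
  by rewrite Q1E setIid tE -EFinM mulfV ?gt_eqF.
by move=> B mB; rewrite -nu1E nu1mu.
Qed.

(** [orbit_mean] only takes values j / N!, hence has countably many level sets. If the level set of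
    a value v had positive mass, conditioning on it and [marginal_ae] would give mu B = v; so the
    level sets of all other values are null. *)
Lemma extreme_ae (mu : probability (borel (power X k)) R)
    (gam : probability (borel (power X N)) R) (B : set (borel (power X k))) :
  extreme_points (Nrep hkN) mu -> symm gam =mu gam -> mu =mu marginal hkN gam ->
  measurable B -> {ae gam, forall y, (orbit_mean hkN y B)%:E = mu B}.
Proof.
move=> muX gamS muE mB.
pose v j : R := N`!%:R^-1 * j%:R.
pose A j := [set y : borel (power X N) | orbit_mean hkN y B = v j].
have mA j : measurable (A j).
  have mf : measurable_fun [set: borel (power X N)] (fun y => orbit_mean hkN y B : R).
    by apply: measurable_funM => //; exact: measurable_orbit_sum.
  by rewrite -[A j]setTI; exact: mf measurableT _ (measurable_set1 (v j)).
have AS j s : rearrange s @^-1` A j = A j.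
  by apply/seteqP; split => y; rewrite /A /= orbit_mean_rearrange.
have A0 j : (v j)%:E <> mu B -> gam (A j) = 0%E.
  move=> vj; apply/eqP/negP => /negP A0.
  have [Q [QS QA QE]] := extreme_conditional _ _ _ muX gamS muE (mA j) (AS j) A0.
  apply: vj; rewrite -QE//; apply/esym/marginal_ae => //.
  exists (~` A j); split => //; first exact: measurableC.
  by rewrite probability_setC// QA subee.
apply: (@negligibleS _ _ _ gam (\bigcup_j (if `[< (v j)%:E = mu B >] then set0 else A j))).
  move=> y /= yB; exists (\sum_(s : 'S_N) (restr hkN (rearrange s y) \in B : nat))%N => //.
  have yv : orbit_mean hkN y B =
      v (\sum_(s : 'S_N) (restr hkN (rearrange s y) \in B : nat))%N.
    by rewrite orbit_meanE /v natr_sum; congr (_ * _).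
  by case: asboolP => // h; apply: yB; rewrite yv.
apply: negligible_bigcup => j; case: asboolP => [_|vj]; first exact: negligible_set0.
by apply/(@negligibleP _ _ _ gam _ (mA j)); exact: A0.
Qed.

(** Countably many almost sure events hold at a common point y because [gam] has mass 1; agreement
    on the pi-system then determines the measure. *)
Lemma extreme_orbit_mean (hX : polish R X) (mu : probability (borel (power X k)) R) :
  extreme_points (Nrep hkN) mu ->
  exists y : 'I_N -> X, mu =mu (fun B => (orbit_mean hkN y B)%:E).
Proof.
move=> muX; have [[gam [gamS muE]] _] := muX.
have [V [mV VI [n0 VT] sV]] := countable_pi_base hX k.
have ae n := extreme_ae _ _ _ muX gamS muE (mV n).
have /ae_foralln aeV := ae.
have PF : ProperFilter (almost_everywhere gam).
  by apply: ae_properfilter_algebraOfSetsType; rewrite [X in (_ < X)%E]probability_setT.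
have [y yV] := filter_ex aeV.
exists y; have [P PE] := orbit_mean_ex y => B mB; rewrite -PE.
apply: (measure_unique (range V) (fun=> setT)) => //.
- by move=> _; exists n0.
- by rewrite bigcup_const.
- by move=> _ [n _ <-]; exact: (etrans (esym (yV n)) (esym (PE _))).
- by move=> _; rewrite [X in (X < _)%E]probability_setT ltry.
Qed.

End extreme.

(** * Exposed points *)

Section permutation_sums.
Context {R : numFieldType} {N : nat}.

(** The sum over s is the same for every a; summing over all a makes each s contribute the full sum
    of h. *)
Lemma sum_perm1 (h : 'I_N -> R) a :
  N%:R * \sum_(s : 'S_N) h (s a) = N`!%:R * \sum_i h i.
Proof.
pose g (w : seq 'I_N) := h (head a w).
have E b : \sum_(s : 'S_N) h (s b) = prefix_sum 1 g.
  by rewrite -(prefix_sum_uniq [:: b]).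
transitivity (\sum_(b < N) \sum_(s : 'S_N) h (s b)).
  by under [RHS]eq_bigr do rewrite E; rewrite E sumr_const card_ord mulr_natl.
rewrite exchange_big /= (eq_bigr (fun=> \sum_i h i)); last first.
  by move=> s _; rewrite [RHS](reindex_inj (@perm_inj _ s)).
by rewrite sumr_const card_Sn mulr_natl.
Qed.

(** The same double counting over the N(N - 1) ordered pairs of distinct indices. *)
Lemma sum_perm2 (h : 'I_N -> 'I_N -> R) a b : a != b ->
  N%:R * (N%:R - 1) * \sum_(s : 'S_N) h (s a) (s b) =
  N`!%:R * \sum_i \sum_(j | j != i) h i j.
Proof.
move=> ab; pose g (w : seq 'I_N) := h (nth a w 0) (nth a w 1).
have E i j : j != i -> \sum_(s : 'S_N) h (s i) (s j) = prefix_sum 2 g.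
  by move=> ij; rewrite -(prefix_sum_uniq [:: i; j])//= inE eq_sym ij.
have N0 : (0 < N)%N by case: (N) a {ab g E} => // -[].
transitivity (\sum_(i < N) \sum_(j < N | j != i) \sum_(s : 'S_N) h (s i) (s j)).
  under [RHS]eq_bigr => i _.
    rewrite (eq_bigr (fun=> prefix_sum 2 g)); last by move=> j; exact: E.
    rewrite sumr_const; over.
  rewrite E 1?eq_sym//.
  under [RHS]eq_bigr => i _.
    rewrite (_ : #|_| = N.-1); last by have := cardC1 i; rewrite card_ord.
    over.
  by rewrite sumr_const card_ord -subn1 -[RHS]mulr_natl -[X in _ =
    _ * X]mulr_natl natrB// mulrA.
under eq_bigr do rewrite exchange_big.
rewrite exchange_big /= (eq_bigr (fun=> \sum_i \sum_(j | j != i) h i j)); last first.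
  move=> s _; rewrite [RHS](reindex_inj (@perm_inj _ s)); apply: eq_bigr => i _.
  rewrite [RHS](reindex_inj (@perm_inj _ s)); apply: eq_bigl => j.
  by rewrite (inj_eq (@perm_inj _ s)).
by rewrite sumr_const card_Sn mulr_natl.
Qed.

End permutation_sums.

Section bounded_continuous.
Context {R : realType} {Y : topologicalType}.
Implicit Types f g : Y -> R.

Definition bcont f := continuous f /\ exists M, forall y, `|f y| <= M.

Lemma bcont_cst c : bcont (fun=> c).
Proof. by split; [move=> y; exact: cvg_cst|exists `|c|]. Qed.

Lemma bcontD f g : bcont f -> bcont g -> bcont (fun y => f y + g y).
Proof.
move=> [cf [M fM]] [cg [M' gM]]; split; first by move=> y; exact: cvgD (cf y) (cg y).
by exists (M + M') => y; rewrite (le_trans (ler_normD _ _))// lerD.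
Qed.

Lemma bcontM f g : bcont f -> bcont g -> bcont (fun y => f y * g y).
Proof.
move=> [cf [M fM]] [cg [M' gM]]; split; first by move=> y; exact: cvgM (cf y) (cg y).
by exists (M * M') => y; rewrite normrM ler_pM.
Qed.

Lemma bcont_sum {I : Type} (s : seq I) (P : pred I) (F : I -> Y -> R) :
  (forall i, bcont (F i)) -> bcont (fun y => \sum_(i <- s | P i) F i y).
Proof.
move=> Fb; elim: s => [|i s IH].
  by under eq_fun do rewrite big_nil; exact: bcont_cst.
under eq_fun do rewrite big_cons; case: (P i) => //.
exact: bcontD.
Qed.

Lemma bcont_prod {I : Type} (s : seq I) (P : pred I) (F : I -> Y -> R) :
  (forall i, bcont (F i)) -> bcont (fun y => \prod_(i <- s | P i) F i y).
Proof.
move=> Fb; elim: s => [|i s IH].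
  by under eq_fun do rewrite big_nil; exact: bcont_cst.
under eq_fun do rewrite big_cons; case: (P i) => //.
exact: bcontM.
Qed.

End bounded_continuous.

Lemma bcont_coord {R : realType} {X : topologicalType} {m} (i : 'I_m) (f : X -> R) :
  bcont f -> bcont (fun z : power X m => f (z i)).
Proof.
move=> [cf [M fM]]; split; last by exists M.
by move=> z; apply: continuous_comp; [exact: continuous_coord|exact: cf].
Qed.

Section separating_functions.
Context {R : realType} {X : ptopologicalType} (hX : polish R X).

(** The distance to p, truncated at 1 to be bounded. *)
Lemma separating_ex : exists b : X -> X -> R,
  [/\ forall p, bcont (b p), forall p a, 0 <= b p a & forall p a, b p a = 0 <-> p = a].
Proof.
have [_ [d [[d0 dE] [dC dT] dN _]]] := hX.
exists (fun p a => Num.min 1 (d p a)); split.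
- move=> p; split; last first.
    by exists 1 => a; rewrite ger0_norm ?le_min ?ler01 ?d0// ge_min lexx.
  move=> a; apply/cvgrPdist_lt => e e0; apply/dN; exists e => // t /= at_e.
  have := dT p a t; have := dT p t a; rewrite (dC t a) => h1 h2.
  by rewrite ltr_norml; apply/andP; case: (leP 1 (d p a)); case: (leP 1 (d p t)); split;
    lra.
- by move=> p a; rewrite le_min ler01 d0.
- move=> p a; split => [|<-]; last by rewrite (dE p p).2 ?min_r ?ler01.
  by case: leP => [_ /eqP|_ /dE//]; rewrite oner_eq0.
Qed.

End separating_functions.

Section exposing.
Context {R : realType} {X : ptopologicalType} (hX : polish R X).
Context {N k : nat} (hk : (2 <= k)%N) (hkN : (k <= N)%N) (x : 'I_N -> X).

(* The constant [C] only serves to make [phi] nonnegative. *)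
Lemma exposing_ex : exists (phi : power X k -> R) (Phi : power X N -> R) (C : R),
  [/\ bcont phi /\ (forall z, 0 <= phi z),
      forall y, 0 <= Phi y, 0 <= C,
      forall y, \sum_(s : 'S_N) phi (restr hkN (rearrange s y)) = N`!%:R * (Phi y + C)
    & forall y, Phi y = 0 <-> exists s, y = rearrange s x].
Proof.
have [b [bb b0 bE]] := separating_ex hX.
(* [g] vanishes exactly at the points of x, and [f i] vanishes at those different from x_i but not
   at x_i. So, when all y_j are points of x, the sum of the f_i(y_j) is f_i(x_i) times the number of
   occurrences of x_i in y. *)
pose g a := \prod_j b (x j) a.
pose f i a := \prod_(j | x j != x i) b (x j) a.
pose c i := \sum_j f i (x j).
have gb : bcont g by apply: bcont_prod.
have fb i : bcont (f i) by apply: bcont_prod.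
pose Phi (y : power X N) := \sum_j g (y j) + \sum_i (\sum_j f i (y j) - c i) ^+ 2.
(* The factors [N] and [N * (N - 1)] compensate the averages over S_N of
   functions of one and of two coordinates. *)
pose Q (z : power X k) : R := let a := z (Ordinal (ltnW hk)) in let a' := z (Ordinal hk) in
  N%:R * g a + \sum_i (N%:R * (f i a * f i a + (- 2 * c i) * f i a) +
    N%:R * (N%:R - 1) * (f i a * f i a') + c i ^+ 2).
have Qb : bcont Q.
  have fbz i l : bcont (fun z : power X k => f i (z l)) by exact: bcont_coord.
  apply: bcontD; first by apply: bcontM; [exact: bcont_cst|exact: bcont_coord].
  apply: bcont_sum => i; apply: bcontD; last exact: bcont_cst.
  apply: bcontD; last by apply: bcontM; [exact: bcont_cst|exact: bcontM].
  apply: bcontM; first exact: bcont_cst.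
  by apply: bcontD; apply: bcontM => //; exact: bcont_cst.
have [_ [M QM]] := Qb.
have M0 : 0 <= M by exact: le_trans (QM point).
have g0 a : 0 <= g a by rewrite prodr_ge0.
exists (fun z => Q z + M), Phi, M; split => //.
- split; first by apply: bcontD Qb _; exact: bcont_cst.
  by move=> z; have := QM z; rewrite ler_norml => /andP[+ _]; lra.
- by move=> y; rewrite addr_ge0// sumr_ge0// => i _; rewrite sqr_ge0.
- move=> y; rewrite big_split /= [RHS]mulrDr sumr_const card_Sn -[M *+ _]mulr_natl;
  congr (_ + _).
  rewrite /Q big_split /= -mulr_sumr exchange_big /=.
  set a := widen_ord hkN (Ordinal (ltnW hk)); set a' := widen_ord hkN (Ordinal hk).
  have aa' : a != a' by [].
  rewrite /Phi [RHS]mulrDr; congr (_ + _).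
    by rewrite -(sum_perm1 (fun j => g (y j)) a).
  rewrite mulr_sumr; apply: eq_bigr => i _.
  (* Expansion of the square: the functions of one coordinate give the diagonal and linear parts,
     those of two coordinates the off-diagonal products. *)
  rewrite !big_split /= -!mulr_sumr sumr_const card_Sn.
  rewrite (sum_perm1 (fun j => f i (y j) * f i (y j) + - 2 * c i * f i (y j)) a).
  rewrite (sum_perm2 (fun j l => f i (y j) * f i (y l)) a a' aa').
  have -> : \sum_j (f i (y j) * f i (y j) + - 2 * c i * f i (y j)) =
    \sum_j f i (y j) * f i (y j) - 2 * c i * \sum_j f i (y j).
    by rewrite big_split /= -mulr_sumr; ring.
  have -> : \sum_j \sum_(l | l != j) f i (y j) * f i (y l) =
    (\sum_j f i (y j)) ^+ 2 - \sum_j f i (y j) * f i (y j).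
    rewrite expr2 mulr_suml -sumrB; apply: eq_bigr => j _.
    by rewrite mulr_sumr [in RHS](bigD1 j)//= addrAC subrr add0r.
  by rewrite -[c i *+ _]mulr_natl; ring.
move=> y; split => [|[s ->]]; last first.
  rewrite /Phi big1 ?add0r; last first.
    move=> j _; rewrite /g (bigD1 (s j))//= (bE _ _).2 ?mul0r//.
  rewrite big1// => i _; rewrite /c [X in _ - X](reindex_inj (@perm_inj _ s)).
  by rewrite subrr expr0n.
(* All terms are nonnegative, hence all vanish: [g] places the y_j among the points of x, then the
   squares fix the multiplicities. *)
rewrite /Phi => /eqP; rewrite paddr_eq0 ?sumr_ge0//; last by move=> i _; rewrite sqr_ge0.
rewrite !psumr_eq0//; last by move=> i _; rewrite sqr_ge0.
move=> /andP[/allP yg /allP yf].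
have yx j : exists l, y j = x l.
  have := yg j (mem_index_enum j); rewrite prodf_seq_eq0 => /hasP[l _ /andP[_ /eqP /bE]].
  by move=> <-; exists l.
have fxx i : f i (x i) != 0.
  rewrite prodf_seq_neq0; apply/allP => j _; apply/implyP => ji.
  by apply: contra ji => /eqP/bE->.
have fx i (u : 'I_N -> X) : (forall j, exists l, u j = x l) ->
    \sum_j f i (u j) = (\sum_j (u j == x i))%:R * f i (x i).
  move=> ux; rewrite natr_sum mulr_suml; apply: eq_bigr => j _.
  have [->|ui] := eqVneq (u j) (x i); first by rewrite mul1r.
  have [l ul] := ux j; rewrite mul0r /f (bigD1 l)/=; first by rewrite -ul (bE _ _).2 ?mul0r.
  by rewrite -ul.
have cnt i : (\sum_j (y j == x i) = \sum_j (x j == x i))%N.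
  have := yf i (mem_index_enum i); rewrite /= sqrf_eq0 subr_eq0 /c.
  rewrite (fx i y yx) (fx i x); last by move=> j; exists j.
  by move=> /eqP/(mulIf (fxx i))/eqP; rewrite eqr_nat => /eqP.
have /tuple_permP[s sE] : perm_eq [tuple y j | j < N] [tuple x j | j < N].
  apply/allP => a; rewrite mem_cat => ain.
  have [l ->] : exists l, a = x l.
    by case/orP: ain => /mapP[j _ ->]; [exact: yx|exists j].
  have C (u : 'I_N -> X) : count_mem (x l) [tuple u j | j < N] = (\sum_j (u j == x l))%N.
    by rewrite -sum1_count big_map big_enum_cond /= -big_mkcondr /=; apply: eq_bigr.
  by rewrite /= !C cnt.
exists s; apply/funext => j.
have /val_inj/(congr1 (fun t => tnth t j)) :
  val [tuple y i | i < N] = val [tuple tnth [tuple x i | i < N] (s i) | i < N] := sE.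
by rewrite !tnth_mktuple.
Qed.

End exposing.

(** * Exposing functions and extremality *)

Section exposed_extreme.
Context {R : realType} {X : ptopologicalType} (hX : polish R X).
Context {N k : nat} (hk : (2 <= k)%N) (hkN : (k <= N)%N).

(** The function is explicit and nonnegative, so that the integration rules for nonnegative
    functions apply. *)
Definition exposing (C : set (probability (borel (power X k)) R))
    (mu : probability (borel (power X k)) R) (phi : power X k -> R) :=
  [/\ bcont phi, forall z, 0 <= phi z
    & forall nu : probability (borel (power X k)) R, C nu -> ~ (nu =mu mu) ->
      (\int[mu]_y (phi y)%:E < \int[nu]_y (phi y)%:E)%E].

Lemma exposing_exposed C mu phi : C mu -> exposing C mu phi -> exposed_points C mu.
Proof. by move=> Cmu [[cphi bphi] _ lt]; split => //; exists phi. Qed.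

(** The integral of [phi] is finite and affine along the convex combination; if [nu1] or [nu2]
    differed from [mu], its strictly larger integral would make the mean exceed the integral against
    [mu]. *)
Lemma exposing_extreme C mu phi : C mu -> exposing C mu phi -> extreme_points C mu.
Proof.
move=> Cmu [[cphi [M phiM]] phi0 philt]; split => // nu1 nu2 t C1 C2 /andP[t0 t1] muE.
have mphi := measurable_borel_real phi cphi.
have mphie : measurable_fun [set: borel (power X k)] (EFin \o phi) by
  exact/measurable_EFinP.
have fin (P : probability (borel (power X k)) R) : (\int[P]_y (phi y)%:E)%E \is a fin_num.
  rewrite ge0_fin_numE; last by apply: integral_ge0 => y _; rewrite lee_fin.
  apply: (@le_lt_trans _ _ (\int[P]_y (M%:E))%E).
    apply: ge0_le_integral => //.
    - by move=> y _; rewrite lee_fin.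
    - by move=> y _; rewrite lee_fin; exact: le_trans (ler_norm _) (phiM y).
  by rewrite integral_cst// [X in (_ * X)%E]probability_setT mule1 ltry.
have t0' : 0 <= t by exact: ltW.
have t1' : 0 <= 1 - t by rewrite subr_ge0 ltW.
have intE : (\int[mu]_y (phi y)%:E =
    t%:E * \int[nu1]_y (phi y)%:E + (1 - t)%:E * \int[nu2]_y (phi y)%:E)%E.
  pose m := measure_add (mscale (NngNum t0') nu1) (mscale (NngNum t1') nu2).
  have mE : mu =mu m by move=> A mA; rewrite muE// /m /= measure_addE.
  rewrite (eq_meas_integral _ _ _ _ _ _ mE) ge0_integral_measure_add//; last first.
    by move=> y _; rewrite lee_fin.
  by rewrite !ge0_integral_mscale// => y _; rewrite lee_fin.
pose I (P : probability (borel (power X k)) R) := fine (\int[P]_y (phi y)%:E)%E.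
have IE (P : probability (borel (power X k)) R) : (\int[P]_y (phi y)%:E)%E = (I P)%:E.
  by rewrite fineK.
have {}intE : I mu = t * I nu1 + (1 - t) * I nu2.
  by apply: EFin_inj; rewrite EFinD !EFinM -!IE.
have ltI (nu : probability (borel (power X k)) R) : C nu -> ~ (nu =mu mu) -> I mu < I nu.
  by move=> Cn nn; rewrite -lte_fin -!IE; exact: philt.
have leI (nu : probability (borel (power X k)) R) : C nu -> I mu <= I nu.
  move=> Cn; have [e|ne] := pselect (nu =mu mu); last exact/ltW/ltI.
  by rewrite -lee_fin -!IE (eq_meas_integral _ _ _ _ _ _ e).
have h1 := leI _ C1; have h2 := leI _ C2.
by split; apply: contrapT => ne; [have := ltI _ C1 ne|have := ltI _ C2 ne]; nra.
Qed.

Lemma Nrep_orbit_mean x (mu : probability (borel (power X k)) R) :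
  mu =mu (fun B => (orbit_mean hkN x B)%:E) -> Nrep hkN mu.
Proof.
move=> muE; have [P [PS _ PE]] := symm_dirac_ex (R := R) hkN x.
by exists P; split => // B mB; rewrite muE// -PE.
Qed.

(** Integrating [phi] against M_k gam gives the [gam]-integral of [Phi] plus C. The minimum C is
    attained at S_N delta_x, and only by those [gam] concentrated on the orbit of x, whose marginal
    is [mu]. *)
Lemma orbit_mean_exposing x (mu : probability (borel (power X k)) R) :
  mu =mu (fun B => (orbit_mean hkN x B)%:E) -> exists phi, exposing (Nrep hkN) mu phi.
Proof.
move=> muE; have [phi [Phi [C [[bphi phi0] Phi0 C0 phiE PhiE]]]] := exposing_ex hX hk hkN x.
exists phi; split => //.
have [cphi _] := bphi; have mphi := measurable_borel_real phi cphi.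
have mphie : measurable_fun [set: borel (power X k)] (EFin \o phi) by
  exact/measurable_EFinP.
have f0 : N`!%:R != 0 :> R by rewrite pnatr_eq0 -lt0n fact_gt0.
have mphir : measurable_fun [set: borel (power X N)] (phi \o restr hkN).
  exact: measurableT_comp mphi (measurable_restr hkN).
(* [Phi] is recovered from [phi] by averaging over S_N, which gives its measurability. *)
have mPhi : measurable_fun [set: borel (power X N)] Phi.
  have -> : Phi = (fun y => N`!%:R^-1 * \sum_(s :
    'S_N) phi (restr hkN (rearrange s y)) - C).
    by apply/funext => y; rewrite phiE mulKf// addrK.
  apply: measurable_funB => //; apply: measurable_funM => //; apply: measurable_sum => s.
  exact: measurableT_comp mphir (measurable_rearrange s).
have mPhie : measurable_fun [set: borel (power X N)] (EFin \o Phi) by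
  exact/measurable_EFinP.
have intE (nu : probability (borel (power X k)) R) (gam :
  probability (borel (power X N)) R) :
    symm gam =mu gam -> nu =mu marginal hkN gam ->
    (\int[nu]_z (phi z)%:E = \int[gam]_y (Phi y)%:E + C%:E)%E.
  move=> gamS nuE; rewrite (eq_meas_integral _ _ _ _ _ _ nuE).
  rewrite (ge0_integral_pushforward (measurable_restr hkN) gam measurableT mphie);
    last first.
    by move=> z _; rewrite lee_fin.
  have := symm_integral gam _ gamS mphir (fun y => phi0 _).
  under [X in _ = X -> _]eq_integral do rewrite phiE EFinM EFinD.
  rewrite ge0_integralZl//.
  - move=> /(EFin_mulfI _ _ _ _ f0) E; rewrite preimage_setT; apply: (etrans E).
    rewrite ge0_integralD//; last by move=> y _; rewrite lee_fin.
    by rewrite integral_cst// [X in (_ * X)%E]probability_setT mule1.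
  - by apply: emeasurable_funD.
  - by move=> y _; rewrite -EFinD lee_fin addr_ge0.
move=> nu [gam [gamS nuE]] nunu.
have [gamx [gamxS gamxE gamxM]] := symm_dirac_ex (R := R) hkN x.
have mux : mu =mu marginal hkN gamx by move=> B mB; rewrite muE// -gamxM.
rewrite (intE _ _ gamxS mux) (intE _ _ gamS nuE).
rewrite (integral_atomic _ _ _ _ _ (Phi : borel (power X N) -> R) _ gamxE)//.
rewrite big_map big1 ?mulr0 ?add0e; last by move=> s _; apply/PhiE; exists s.
rewrite lteDr// lt_def integral_ge0 ?andbT; last by move=> y _; rewrite lee_fin.
(* A zero integral would force [Phi] = 0 almost everywhere, so that almost every y is a
   rearrangement of x. *)
apply/eqP => I0; apply: nunu => B mB; rewrite nuE// muE//.
apply: marginal_ae => //.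
have : ae_eq gam setT (EFin \o Phi) (cst 0%E).
  apply/ae_eq_integral_abs => //; rewrite -I0; apply: eq_integral => y _.
  by rewrite /= ger0_norm.
apply: filterS => y /= /(_ I)[/PhiE[s ->]].
exact: orbit_mean_rearrange.
Qed.

End exposed_extreme.

Theorem theorem5p3 (R : realType) (X : ptopologicalType) (hX : polish R X)
    (N k : nat) (hk : (2 <= k)%N) (hkN : (k <= N)%N) :
  (eq_mset [set (mu : set (borel (power X k)) -> \bar R)
             | mu in extreme_points (@Nrep R X k N hkN)]
           (@EF R X N k) /\
   eq_mset (@EF R X N k) (@Edirac R X N k hkN)) /\
  (forall mu : probability (borel (power X k)) R,
     extreme_points (@Nrep R X k N hkN) mu ->
     exposed_points (@Nrep R X k N hkN) mu).
Proof.
have k0 : (0 < k)%N by exact: ltnW.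
have N0 : (0 < N)%N by exact: leq_trans hkN.
have FE (la : probability (borel X) R) (x : 'I_N -> X) :
    la =mu (fun A => (N%:R^-1)%:E * \sum_(i < N) dirac (x i : borel X) A)%E ->
    Fmeas N k la =mu (fun B => (orbit_mean hkN x B)%:E).
  move=> laE B mB; rewrite (Fmeas_symm_dirac hkN x (Ordinal N0) la laE k0 B mB).
  exact: marginal_symm_dirac.
have laex (x : 'I_N -> X) : exists2 la : probability (borel X) R, quantized N la &
    la =mu (fun A => (N%:R^-1)%:E * \sum_(i < N) dirac (x i : borel X) A)%E.
  have [|la laE] := @empirical_ex _ (borel X) R [seq (x i : borel X) | i <- enum 'I_N].
    by rewrite size_map size_enum_ord.
  have laE' : la =mu (fun A => (N%:R^-1)%:E * \sum_(i < N) dirac (x i : borel X) A)%E.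
    by move=> A mA; rewrite laE size_map size_enum_ord big_map big_enum EFinM -sumEFin.
  by exists la => //; exists x.
have EX (mu : probability (borel (power X k)) R) (x : 'I_N -> X) :
    mu =mu (fun B => (orbit_mean hkN x B)%:E) ->
    extreme_points (Nrep hkN) mu /\ exposed_points (Nrep hkN) mu.
  move=> muE; have muN := Nrep_orbit_mean hkN x mu muE.
  have [phi phiP] := orbit_mean_exposing hX hk hkN x mu muE.
  by split; [exact: exposing_extreme phiP|exact: exposing_exposed phiP].
split; last first.
  by move=> mu /(extreme_orbit_mean hkN hX)[x /EX[]].
split; split.
- move=> _ [mu /(extreme_orbit_mean hkN hX)[x muE] <-].
  have [la laQ laE] := laex x; exists (Fmeas N k la); first by exists la.
  by move=> B mB; rewrite muE// (FE _ _ laE).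
(* [Fmeas] is only a set function, whereas extreme points are packaged probabilities; [P] is a
   probability agreeing with it on Borel sets. *)
- move=> _ [la [x laE] <-]; have [P PE] := orbit_mean_ex (R := R) hkN x.
  have /EX[PX _] : P =mu (fun B => (orbit_mean hkN x B)%:E) by move=> B _.
  exists P; first by exists P.
  by move=> B mB; rewrite (FE _ _ laE)// PE.
- move=> _ [la [x laE] <-]; exists (marginal hkN (symm (dirac (x : borel (power X N))))).
    by exists x.
  by move=> B mB; rewrite (FE _ _ laE)// marginal_symm_dirac.
- move=> _ [x _ <-]; have [la laQ laE] := laex x; exists (Fmeas N k la); first by exists la.
  by move=> B mB; rewrite (FE _ _ laE)// marginal_symm_dirac.
Qed.
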